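(* Let $\gamma>0$ be an arbitrary positive constant. Then for every sufficiently large prime $p$ (in terms of $\gamma$), $$\mathrm{OL}(\mathbf{F}_p^3)\le (2+\gamma)p.$$
   Context: $\mathbf{F}_p$ is the finite field with $p$ elements. A subset $A$ (with distinct elements) of an additive group $G$ is zero-sum-free if $0\notin S_A$, where $S_A=\{\sum_{x\in B}x : B\subset A,\ 0<|B|<\infty\}$. The Olson constant $\mathrm{OL}(G)$ of a finite additive group $G$ is the smallest integer such that no subset of $G$ of cardinality $\mathrm{OL}(G)$ is zero-sum-free. *)

(* Defs.v *)
From HB Require Import structures.
From mathcomp Require Import all_boot all_order all_algebra.
Set Implicit Arguments.
Unset Strict Implicit.
Unset Printing Implicit Defensive.
Import GRing.Theory.
Local Open Scope ring_scope.

Section OlsonConstant.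
Variable G : finZmodType.

Definition subset_sums (A : {set G}) : {set G} :=
  [set \sum_(x in B) x | B : {set G} in powerset A & B != set0].

Definition zero_sum_free (A : {set G}) : bool := 0 \notin subset_sums A.

Definition no_zero_sum_free_of_card (n : nat) : bool :=
  [forall A : {set G}, (#|A| == n) ==> ~~ zero_sum_free A].

(* Any n > #|G| qualifies vacuously, so the minimum below exists. *)
Lemma no_zero_sum_free_of_card_ex : exists n, no_zero_sum_free_of_card n.
Proof.
exists #|G|.+1; apply/forallP => A; apply/implyP => /eqP cardA.
by have := max_card (mem A); rewrite cardA ltnn.
Qed.

Definition olson_constant : nat := ex_minn no_zero_sum_free_of_card_ex.

End OlsonConstant.

(* Main.v *)
Require Import Defs.
From mathcomp Require Import all_boot all_order all_algebra.
From mathcomp Require Import reals.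
From mathcomp Require Import all_field zify ring.
Set Implicit Arguments.
Unset Strict Implicit.
Unset Printing Implicit Defensive.
Import Order.TTheory GRing.Theory Num.Theory.
Local Open Scope ring_scope.

(** Let V be the space of dimension 3 over the field of p elements, and let A be
a subset of V with at least (2 + 1/k) p elements. The idea is to spend a small
part R of A, of size at most p / k' for a large constant k', so that the sums of
subsets of R fill a whole coset x + H of a nonzero subspace H, and then to use
the remaining elements of A only modulo H: a sum that is congruent to - x modulo
H is completed to 0 by a subset of R. Since dim V / H <= 2, about 2 p elements
suffice for the second part.

Finding H ([coset_in_subset_sums]). Suppose that the sums of subsets of R
contain a translate of a set U of a subspace H. Two further elements a, b of A
with b - a = c in H enlarge U to the union of U and U + c. Pairs are added
greedily as long as this multiplies U by 1 + 1/N, which can happen only O(N log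
p) times ([grow_subset_sums]). When it stops, U is nearly invariant under all
available differences c. Now look at the Fourier transform of U at a nonzero
frequency w. If it exceeds half of its maximum, then the near invariance forces
the character w to be close to 1 at every c, so that w takes only O(p / N)
values on the differences ([almost_trivial_shift], [card_almost_trivial]).
Otherwise the process is repeated with fresh elements; after O(log p)
repetitions the sum of the sets U has all its nonzero frequencies negligible, so
that it is all of H ([flat_neq0]). Hence either a coset of H is obtained, or,
apart from the elements already spent, A meets only O(p / N) times more cosets
of ker w than of H ([cover_or_character]). In the second case H is replaced by
ker w. With N of order p / log^2 p, reaching H = 0 would confine nearly all of A
to polylogarithmically many points, which contradicts the distinctness of the
elements of A. The argument also shows that A \ R meets few cosets of the
subspace H that is found.

Using H. If H has codimension 1 and p - 1 of the remaining elements lie outside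
H, their subset sums reach every class modulo H ([zero_sum_codim1]); otherwise
all but about p elements of A lie in H, and one descends from the space to a
plane, which then contains (1 + 1/(2 k)) p elements, or from a plane to a line,
which then contains a positive proportion of p elements
([dense_zero_sum_descend]). If H is a line, the remaining 2 p elements are
viewed in the plane V / H, where they take few values. Unless a plane through H
contains at least (1 + 1/(2 k)) p elements, which again allows a descent, their
subset sums are the whole of V / H ([spread_subset_sums]).

That last fact is proved with the polynomial method. If a sum is missed by a
family of pairs (a_i, b_i), then for every subfamily D of size 2 (p - 1) the
coefficient of X^(p-1) in the product over D of a_i X + b_i is zero
([missed_sum_coef0]). Exchanging s disjoint independent pairs shows that for a
subfamily E of size 2 (p - 1) - s the product f over E has a gap of s + 1 zero
coefficients ending at X^(p-1) ([coef_exchange]). Thus f = X^p P + Q with P and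
Q of small degree, and the Wronskian f P' - f' P = Q P' - Q' P is divisible by
the common part of f and f'. When f has few distinct roots, comparing degrees
makes the Wronskian vanish, so Q = a P and f = (X + a)^p P, a root of
multiplicity p ([no_coef_gap]). *)

(** * Additive characters of a prime field *)

Section Character.
Variables (p : nat) (p_pr : prime p) (z : algC) (z_prim : p.-primitive_root z).

Definition echar (a : 'F_p) : algC := z ^+ a.

Lemma echarD a b : echar (a + b) = echar a * echar b.
Proof.
rewrite /echar -exprD -[RHS](prim_expr_mod z_prim) /=.
by rewrite [X in (_ %% X)%N](Fp_cast p_pr).
Qed.

Lemma echar0 : echar 0 = 1.
Proof. by rewrite /echar expr0. Qed.

Lemma echarN a : echar (- a) * echar a = 1.
Proof. by rewrite -echarD addNr echar0. Qed.

Lemma echar_neq0 a : echar a != 0.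
Proof. by apply/eqP => e0; have := echarN a; rewrite e0 mulr0 => /esym/eqP; rewrite oner_eq0. Qed.

Lemma norm_echar a : `|echar a| = 1.
Proof.
apply/eqP; rewrite -(@pexpr_eq1 _ _ p) ?prime_gt0 ?normr_ge0 //.
by rewrite -normrX /echar -exprM mulnC exprM (prim_expr_order z_prim) expr1n normr1.
Qed.

Lemma conj_echar a : (echar a)^* = echar (- a).
Proof.
apply: (mulIf (echar_neq0 a)).
by rewrite echarN mulrC -normCK norm_echar expr1n.
Qed.

Lemma echar_eq1 a : (echar a == 1) = (a == 0).
Proof.
rewrite /echar -(prim_order_dvd z_prim) -(inj_eq val_inj) /= -{2}(@modn_small a p).
  by rewrite /dvdn.
by rewrite -{2}(Fp_cast p_pr) ltn_ord.
Qed.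

Lemma sum_echar_Fp (a : 'F_p) : \sum_k echar (k * a) = if a == 0 then p%:R else 0.
Proof.
case: eqP => [->|/eqP a0].
  under eq_bigr do rewrite mulr0 echar0.
  by rewrite sumr_const card_Fp.
set S := LHS.
have: S * echar a = S.
  rewrite [RHS](reindex_inj (@addIr _ 1)) /= mulr_suml.
  by apply: eq_bigr => k _; rewrite mulrDl mul1r echarD.
move/eqP; rewrite -subr_eq0 -{2}[S]mulr1 -mulrBr mulf_eq0 subr_eq0 echar_eq1 (negPf a0) orbF.
by move/eqP.
Qed.

(** A Fejer kernel count: the squared modulus of the sum of the first m powers
of [echar k] has total mass p m over all k, while it is at least m^2 / 4 when
[echar k] is so close to 1 that these m powers stay within 1/2 of 1. *)
Lemma card_almost_trivial (N m : nat) (K : {set 'F_p}) :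
    (0 < m <= p)%N -> (8 * m <= N)%N ->
    (forall k, k \in K -> N%:R * `|1 - echar k| <= 4%:R) ->
  (#|K| * m <= 4 * p)%N.
Proof.
move=> /andP[m0 mp] mN HK.
pose F (k : 'F_p) := \sum_(j < m) echar (k *+ j).
have normF k : k \in K -> m%:R / 2 <= `|F k|.
  move=> kK.
  have step j : `|1 - echar (k *+ j)| <= j%:R * `|1 - echar k|.
    elim: j => [|j IH]; first by rewrite mulr0n echar0 subrr normr0 mul0r.
    have -> : 1 - echar (k *+ j.+1) = (1 - echar (k *+ j)) + echar (k *+ j) * (1 - echar k).
      by rewrite mulrSr echarD; ring.
    apply: (le_trans (ler_normD _ _)).
    by rewrite normrM norm_echar mul1r -natr1 mulrDl mul1r lerD2r.
  have half (j : 'I_m) : `|1 - echar (k *+ j)| <= 2^-1.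
    apply: (le_trans (step j)).
    have N0 : (0 < N)%N by lia.
    rewrite -(@ler_pM2l _ N%:R) ?ltr0n //.
    rewrite mulrCA; apply: (@le_trans _ _ (j%:R * 4%:R)).
      by rewrite ler_wpM2l ?ler0n // HK.
    rewrite ler_pdivlMr ?ltr0n // -!natrM ler_nat.
    by have := ltn_ord j; lia.
  have -> : m%:R / 2 = m%:R - m%:R / 2 :> algC by field.
  have -> : F k = m%:R - \sum_(j < m) (1 - echar (k *+ j)).
    by rewrite sumrB sumr_const card_ord opprB addrCA subrr addr0.
  apply: le_trans (lerB_dist _ _); rewrite normr_nat lerD2l lerN2.
  apply: (le_trans (ler_norm_sum _ _ _)).
  apply: (le_trans (ler_sum _ (fun j _ => half j))).
  by rewrite sumr_const card_ord -[leLHS]mulr_natl.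
(* Expanding the square, only the diagonal terms survive the sum over k. *)
have total : \sum_k `|F k| ^+ 2 = (p * m)%:R.
  transitivity (\sum_(i < m) \sum_(j < m) \sum_k echar (k * (i%:R - j%:R))).
    under eq_bigr => k _.
      rewrite normCK /F rmorph_sum mulr_suml /=.
      under eq_bigr => i _.
        rewrite mulr_sumr /=.
        under eq_bigr => j _.
          rewrite conj_echar -echarD.
          have -> : k *+ i - k *+ j = k * (i%:R - j%:R).
            by rewrite mulrBr !mulr_natr.
          over.
        over.
      over.
    rewrite exchange_big /=; apply: eq_bigr => i _.
    by rewrite exchange_big.
  under eq_bigr => i _.
    under eq_bigr => j _ do rewrite sum_echar_Fp.
    rewrite (bigD1 i) //= subrr eqxx big1 ?addr0; last first.
      move=> j ji; case: eqP => // /eqP.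
      rewrite subr_eq0 -(inj_eq val_inj) /= !val_Fp_nat // !modn_small ?(leq_trans _ mp) //.
      by move/eqP/ord_inj => ij; rewrite ij eqxx in ji.
    over.
  by rewrite sumr_const card_ord mulrnA.
have m2 : (#|K| * m ^ 2 <= 4 * (p * m))%N.
  rewrite -(@ler_nat algC) [X in _ <= X]natrM -total mulr_sumr.
  rewrite (bigID (mem K)) /= natrM mulr_natl -sumr_const.
  rewrite -[leLHS]addr0 lerD //; last first.
    by apply: sumr_ge0 => k _; rewrite mulr_ge0 ?ler0n ?exprn_ge0.
  apply: ler_sum => k kK.
  have := normF k kK; rewrite natrX => nF.
  have -> : m%:R ^+ 2 = 4%:R * (m%:R / 2) ^+ 2 :> algC by field.
  rewrite ler_pM2l ?ltr0n // lerXn2r ?nnegrE ?divr_ge0 ?ler0n //.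
by move: m2; rewrite expnS expn1 !mulnA leq_pmul2r.
Qed.

(** * Fourier analysis on row spaces *)

Section Fourier.
Variable h : nat.
Implicit Types (v u : 'rV['F_p]_h) (w : 'cV['F_p]_h) (U : {set 'rV['F_p]_h}).

Definition pair_char v w : algC := echar ((v *m w) 0 0).

Lemma pair_charDl v u w : pair_char (v + u) w = pair_char v w * pair_char u w.
Proof. by rewrite /pair_char mulmxDl mxE echarD. Qed.

Lemma pair_charDr v w w' : pair_char v (w + w') = pair_char v w * pair_char v w'.
Proof. by rewrite /pair_char mulmxDr mxE echarD. Qed.

Lemma pair_char0r v : pair_char v 0 = 1.
Proof. by rewrite /pair_char mulmx0 mxE echar0. Qed.

Lemma pair_char0l w : pair_char 0 w = 1.
Proof. by rewrite /pair_char mul0mx mxE echar0. Qed.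

Lemma norm_pair_char v w : `|pair_char v w| = 1.
Proof. exact: norm_echar. Qed.

Lemma sum_pair_char v :
  \sum_w pair_char v w = if v == 0 then (p ^ h)%:R else 0.
Proof.
case: eqP => [->|/eqP v0].
  under eq_bigr do rewrite pair_char0l.
  by rewrite sumr_const card_mx muln1 card_Fp.
have [j vj] : exists j, v 0 j != 0.
  by apply/existsP; rewrite -negb_forall; apply: contra v0 => /forallP H;
     apply/eqP/rowP => j; rewrite mxE; apply/eqP.
pose w0 : 'cV['F_p]_h := delta_mx j 0.
have vw0 : pair_char v w0 != 1.
  by rewrite /pair_char -colE mxE echar_eq1.
set S := LHS.
have: S * pair_char v w0 = S.
  rewrite [RHS](reindex_inj (@addIr _ w0)) /= mulr_suml.
  by apply: eq_bigr => w _; rewrite pair_charDr.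
move/eqP; rewrite -subr_eq0 -{2}[S]mulr1 -mulrBr mulf_eq0 subr_eq0 (negPf vw0) orbF.
by move/eqP.
Qed.

Definition fourier (g : 'rV['F_p]_h -> algC) w : algC :=
  \sum_v g v * pair_char v w.

Lemma fourier_inversion g v :
  \sum_w fourier g w * pair_char (- v) w = (p ^ h)%:R * g v.
Proof.
under eq_bigr => w _.
  rewrite /fourier mulr_suml.
  under eq_bigr => u _ do rewrite -mulrA -pair_charDl.
  over.
rewrite exchange_big /=.
under eq_bigr => u _ do rewrite -mulr_sumr sum_pair_char subr_eq0.
rewrite (bigD1 v) //= eqxx big1 ?addr0; first by rewrite mulrC.
by move=> u /negPf ->; rewrite mulr0.
Qed.

Definition set_fourier U w : algC := \sum_(u in U) pair_char u w.

Definition conv_set (g : 'rV['F_p]_h -> algC) U v : algC :=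
  \sum_(u in U) g (v - u).

Lemma fourier_conv_set g U w :
  fourier (conv_set g U) w = fourier g w * set_fourier U w.
Proof.
rewrite /fourier /conv_set /set_fourier.
under eq_bigr do rewrite mulr_suml.
rewrite exchange_big mulr_sumr /=; apply: eq_bigr => u _.
rewrite (reindex_inj (@addIr _ u)) mulr_suml /=.
by apply: eq_bigr => v _; rewrite addrK pair_charDl mulrA.
Qed.

Lemma set_fourier0 U : set_fourier U 0 = #|U|%:R.
Proof.
rewrite /set_fourier; under eq_bigr do rewrite pair_char0r.
by rewrite sumr_const.
Qed.

(** The number i of factors measures the decay: each convolution with a set
whose Fourier transform is at most half of its maximum off 0 gains a factor 2.
*)
Definition flat (i : nat) (g : 'rV['F_p]_h -> algC) : Prop :=
  fourier g 0 != 0 /\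
  forall w, w != 0 -> `|fourier g w| * (2 ^ i)%:R <= `|fourier g 0|.

Lemma flat_conv_set i g U : flat i g -> U != set0 ->
    (forall w, w != 0 -> `|set_fourier U w| * 2 <= #|U|%:R) ->
  flat i.+1 (conv_set g U).
Proof.
move=> [g0 gf] U0 Uf; split.
  by rewrite fourier_conv_set mulf_neq0 // set_fourier0 pnatr_eq0 cards_eq0.
move=> w w0; rewrite !fourier_conv_set !normrM set_fourier0 normr_nat expnS mulnC natrM mulrACA.
by rewrite ler_pM ?mulr_ge0 ?normr_ge0 ?ler0n ?gf ?Uf.
Qed.

(** In the inversion formula at v the term of frequency 0 dominates, because the
other frequencies are fewer than 2^t and each one is 2^t times smaller. *)
Lemma flat_neq0 t g v : (p ^ h <= 2 ^ t)%N -> flat t g -> g v != 0.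
Proof.
move=> pt [g0 gf]; apply/eqP => gv0.
have := fourier_inversion g v.
rewrite gv0 mulr0 (bigD1 0) //= pair_char0r mulr1 => /eqP.
rewrite addr_eq0 => /eqP E.
have P2 : 0 < (2 ^ t)%:R :> algC by rewrite ltr0n expn_gt0.
have: `|fourier g 0| * (2 ^ t)%:R <= `|fourier g 0| * ((p ^ h).-1)%:R.
  rewrite {1}E normrN.
  apply: (@le_trans _ _ (\sum_(w | w != 0) `|fourier g w| * (2 ^ t)%:R)).
    rewrite -mulr_suml ler_pM2r //; apply: le_trans (ler_norm_sum _ _ _) _.
    by apply: ler_sum => w _; rewrite normrM norm_pair_char mulr1.
  apply: le_trans (ler_sum _ gf) _; rewrite sumr_const mulr_natr.
  rewrite (_ : #|_| = (p ^ h).-1) //.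
  have := cardC1 (0 : 'cV['F_p]_h).
  by rewrite card_mx muln1 card_Fp // => <-; apply: eq_card => w; rewrite !inE.
rewrite ler_pM2l ?normr_gt0 // ler_nat.
have: (0 < p ^ h)%N by rewrite expn_gt0 prime_gt0.
by lia.
Qed.

Definition shift_set (c : 'rV['F_p]_h) U := [set u + c | u in U].

Lemma set_fourier_shift U c w :
  set_fourier (shift_set c U) w = set_fourier U w * pair_char c w.
Proof.
rewrite /set_fourier big_imset /=; last by move=> x y _ _; apply: addIr.
by rewrite mulr_suml; apply: eq_bigr => u _; rewrite pair_charDl.
Qed.

Lemma norm_set_fourier_le U w : `|set_fourier U w| <= #|U|%:R.
Proof.
apply: le_trans (ler_norm_sum _ _ _) _; rewrite -sumr_const.
by apply: ler_sum => u _; rewrite norm_pair_char.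
Qed.

(** Translating U by c multiplies its Fourier transform by a character value,
but changes only the few terms of the symmetric difference. So the character
value can differ from 1 only slightly, unless the transform itself is small. *)
Lemma almost_trivial_shift N U c w : (0 < N)%N ->
    (N * #|shift_set c U :\: U| <= #|U|)%N -> #|U|%:R < `|set_fourier U w| * 2 ->
  N%:R * `|1 - pair_char c w| <= 4%:R.
Proof.
move=> N0 HU Hw.
set U' := shift_set c U in HU *.
have cU : #|U'| = #|U| by rewrite card_imset //; apply: addIr.
have sp X Y : set_fourier X w = set_fourier (X :&: Y) w + set_fourier (X :\: Y) w.
  by rewrite /set_fourier -big_setID.
have cD : #|U :\: U'| = #|U' :\: U|.
  by apply/eqP; rewrite -(eqn_add2l #|U :&: U'|) cardsID setIC cardsID cU.
have E : set_fourier U w * (1 - pair_char c w)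
         = set_fourier (U :\: U') w - set_fourier (U' :\: U) w.
  rewrite mulrBr mulr1 -set_fourier_shift (sp U U') (sp U' U) setIC.
  by rewrite opprD addrACA subrr add0r.
have D : `|set_fourier U w| * `|1 - pair_char c w| <= 2 * #|U' :\: U|%:R.
  rewrite -normrM E; apply: le_trans (ler_normB _ _) _.
  by rewrite mulr_natl mulr2n lerD // ?norm_set_fourier_le // -cD norm_set_fourier_le.
have s0 : 0 < `|set_fourier U w|.
  have: 0 < `|set_fourier U w| * 2 by apply: le_lt_trans Hw; rewrite ler0n.
  by rewrite pmulr_lgt0 // ltr0n.
rewrite -(ler_pM2l s0) mulrCA.
apply: (@le_trans _ _ (N%:R * (2 * #|U' :\: U|%:R))).
  by rewrite ler_pM2l // ltr0n.
rewrite mulrCA -natrM; apply: (@le_trans _ _ (2 * #|U|%:R)).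
  by rewrite ler_pM2l ?ltr0n // ler_nat.
apply: (@le_trans _ _ (2 * (`|set_fourier U w| * 2))); first by rewrite ler_pM2l ?ltr0n // ltW.
by rewrite mulrCA -natrM.
Qed.

End Fourier.
End Character.

(** * Growing sets of subset sums *)

Section Realize.
Variables (p : nat) (p_pr : prime p) (n : nat).
Local Notation V := 'rV['F_p]_n.
Implicit Types (A R B X : {set V}).

Definition subset_sum R (v : V) : Prop :=
  exists2 B : {set V}, B \subset R & \sum_(b in B) b = v.

Lemma subset_sumU R1 R2 v1 v2 : [disjoint R1 & R2] ->
  subset_sum R1 v1 -> subset_sum R2 v2 -> subset_sum (R1 :|: R2) (v1 + v2).
Proof.
move=> dR [B1 sB1 <-] [B2 sB2 <-]; exists (B1 :|: B2); first exact: setUSS.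

rewrite -bigU ?(disjointW sB1 sB2) //.
by apply: eq_bigl => v; rewrite !inE.
Qed.

Lemma subset_sumS R1 R2 v : R1 \subset R2 -> subset_sum R1 v -> subset_sum R2 v.
Proof. by move=> s [B sB <-]; exists B => //; apply: subset_trans sB s. Qed.

(** The base point x is arbitrary: choosing one element out of each of several
pairs (a, b) with b - a in the row space of M gives sums that differ by elements
of the row space, while their common part, the sum of the a, need not lie in it.
*)
Definition realizes h R (M : 'M['F_p]_(h, n)) (U : {set 'rV['F_p]_h}) : Prop :=
  exists x : V, forall u, u \in U -> subset_sum R (x + u *m M).

Lemma realizesS h R1 R2 (M : 'M_(h, n)) (U1 U2 : {set 'rV_h}) : R1 \subset R2 -> U2 \subset U1 ->
  realizes R1 M U1 -> realizes R2 M U2.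
Proof.
move=> sR /subsetP sU [x Hx]; exists x => u uU.
by apply: subset_sumS sR _; apply/Hx/sU.
Qed.

Lemma realizes_set0 h (M : 'M_(h, n)) : realizes set0 M [set 0].
Proof.
exists 0 => u /set1P ->; rewrite mul0mx addr0.
by exists set0; rewrite ?sub0set ?big_set0.
Qed.

Lemma realizes_pair h (M : 'M_(h, n)) a b c : a != b -> b - a = c *m M ->
  realizes [set a; b] M [set 0; c].
Proof.
move=> ab E; exists a => u /set2P[->|->].
  rewrite mul0mx addr0; exists [set a]; last by rewrite big_set1.
  by rewrite sub1set !inE eqxx.
rewrite -E addrCA subrr addr0; exists [set b]; last by rewrite big_set1.
by rewrite sub1set !inE eqxx orbT.
Qed.

Lemma realizesU h R1 R2 (M : 'M_(h, n)) (U1 U2 U : {set 'rV_h}) : [disjoint R1 & R2] ->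
    (forall u, u \in U -> exists2 u1, u1 \in U1 & u - u1 \in U2) ->
  realizes R1 M U1 -> realizes R2 M U2 -> realizes (R1 :|: R2) M U.
Proof.
move=> dR HU [x1 H1] [x2 H2]; exists (x1 + x2) => u /HU[u1 u1U u2U].
have -> : x1 + x2 + u *m M = (x1 + u1 *m M) + (x2 + (u - u1) *m M).
  by rewrite mulmxBl addrACA (addrC (u1 *m M)) subrK.
by apply: subset_sumU => //; [apply: H1 | apply: H2].
Qed.

(** While some pair of unused elements has a difference c in the row space for
which U + c contributes more than #|U| / N new points, adding this pair
multiplies #|U| by 1 + 1/N. A subset of a space of size p^h allows fewer than T
such steps. *)
Lemma grow_subset_sums h (M : 'M_(h, n)) N T A : (0 < N)%N ->
    (N ^ T * p ^ h < N.+1 ^ T)%N ->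
  exists R U, [/\ R \subset A, (#|R| <= 2 * T)%N, U != set0, realizes R M U &
    forall a b c, a \in A :\: R -> b \in A :\: R -> a != b -> b - a = c *m M ->
      (N * #|shift_set c U :\: U| <= #|U|)%N].
Proof.
move=> N0 HT.
suff: exists R U, [/\ R \subset A, (#|R| <= 2 * T)%N, U != set0, realizes R M U &
    (forall a b c, a \in A :\: R -> b \in A :\: R -> a != b -> b - a = c *m M ->
      (N * #|shift_set c U :\: U| <= #|U|)%N) \/ (N.+1 ^ T <= N ^ T * #|U|)%N].
  move=> [R [U [sR cR U0 RU [H|H]]]]; exists R, U; split=> //.
  have: (#|U| <= p ^ h)%N by rewrite (leq_trans (max_card _)) // card_mx mul1n card_Fp.
  rewrite -(leq_pmul2l (_ : 0 < N ^ T)%N) ?expn_gt0 ?N0 //.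
  by move/(leq_trans H)/leq_ltn_trans/(_ HT); rewrite ltnn.
elim: T {HT} => [|T [R [U [sR cR U0 RU [H|H]]]]].
- exists set0, [set 0]; split; rewrite ?sub0set ?cards0 //; last by right; rewrite cards1.
    by apply/set0Pn; exists 0; rewrite inE.
  exact: realizes_set0.
- by exists R, U; split=> //; [rewrite (leq_trans cR) // leq_mul2l leqnSn | left].
pose bad (x : V * V * 'rV['F_p]_h) := [&& x.1.1 \in A :\: R, x.1.2 \in A :\: R, x.1.1 != x.1.2,
   x.1.2 - x.1.1 == x.2 *m M & (#|U| < N * #|shift_set x.2 U :\: U|)%N].
have [[[a b] c] /and5P[/= aA bA ab /eqP abc Hc]|nobad] := pickP bad; last first.
  exists R, U; split=> //; first by rewrite (leq_trans cR) // leq_mul2l leqnSn.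
  left=> a b c aA bA ab abc; rewrite leqNgt; apply/negP => Hc.
  by have := nobad (a, b, c); rewrite /bad /= aA bA ab abc eqxx Hc.
exists (R :|: [set a; b]), (U :|: shift_set c U).
move: aA bA; rewrite !inE => /andP[aR aA] /andP[bR bA].
split.
- by rewrite subUset sR subUset !sub1set aA bA.
- apply: (leq_trans (leq_card_setU _ _)); rewrite mulnS addnC leq_add //.
  by rewrite cards2; case: (_ != _).
- by apply: contra U0; rewrite setU_eq0 => /andP[].
- apply: (realizesU _ _ RU (realizes_pair ab abc)).
    by rewrite disjoint_sym -setI_eq0; apply/eqP/setP=> x; rewrite !inE;
       case: eqP => [->|_]; rewrite ?(negPf aR) //; case: eqP => [->|_]; rewrite ?(negPf bR).
  move=> u /setUP[uU|/imsetP[v vU ->]].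
    by exists u => //; rewrite subrr !inE eqxx.
  by exists v => //; rewrite addrC addKr !inE eqxx orbT.
right.
have -> : #|U :|: shift_set c U| = (#|U| + #|shift_set c U :\: U|)%N.
  have -> : U :|: shift_set c U = U :|: (shift_set c U :\: U).
    by apply/setP => x; rewrite !inE; case: (x \in U).
  rewrite cardsU (_ : U :&: (shift_set c U :\: U) = set0) ?cards0 ?subn0 //.
  by apply/setP => x; rewrite !inE; case: (x \in U).
rewrite !expnS; move: Hc H; move: #|_ :\: _| #|U| (N ^ T)%N (N.+1 ^ T)%N => d k x y.
by nia.
Qed.

End Realize.

(** * A coset filled by few elements *)

Section CosetSearch.
Variables (p : nat) (p_pr : prime p) (n : nat).
Local Notation V := 'rV['F_p]_n.
Implicit Types (A R B X : {set V}).

(** Repeated growth, each time with fresh elements. As soon as one of the grown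
sets has a large Fourier coefficient, its frequency w is the required character;
if this never happens, the convolution of the t sets is flat enough to be
nonzero everywhere. *)
Lemma cover_or_character h (M : 'M_(h, n)) N m T t A :
    (0 < m <= p)%N -> (8 * m <= N)%N ->
    (N ^ T * p ^ h < N.+1 ^ T)%N -> (p ^ h <= 2 ^ t)%N ->
  exists2 R : {set V}, R \subset A /\ (#|R| <= 2 * T * t)%N &
    realizes R M setT \/
    exists2 w : 'cV['F_p]_h, w != 0 & exists2 K : {set 'F_p}, 0 \in K /\ (#|K| * m <= 4 * p)%N &
      forall a b c, a \in A :\: R -> b \in A :\: R -> a != b -> b - a = c *m M ->
        (c *m w) 0 0 \in K.
Proof.
move=> m0p mN HT Ht.
have N0 : (0 < N)%N by lia.
have [z zP] := C_prim_root_exists (prime_gt0 p_pr).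
pose K := [set k : 'F_p | N%:R * `|1 - echar z k| <= 4%:R].
have K0 : 0 \in K by rewrite inE echar0 subrr normr0 mulr0 ler0n.
have cK : (#|K| * m <= 4 * p)%N.
  by apply: (card_almost_trivial p_pr zP m0p mN) => k; rewrite inE.
suff: exists2 R : {set V}, R \subset A /\ (#|R| <= 2 * T * t)%N &
    (exists2 g, flat z t g & realizes R M [set v | g v != 0]) \/
    exists2 w : 'cV['F_p]_h, w != 0 &
      forall a b c, a \in A :\: R -> b \in A :\: R -> a != b -> b - a = c *m M ->
        (c *m w) 0 0 \in K.
  move=> [R sR [[g fg Rg]|[w w0 Hw]]]; exists R => //; last by right; exists w => //; exists K.
  left; apply: realizesS Rg => //; apply/subsetP => v _.
  by rewrite inE (flat_neq0 p_pr zP v Ht).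
elim: t {Ht} => [|t [R [sR cR] [[g fg Rg]|[w w0 Hw]]]]; last first.
- exists R; last by right; exists w.
  by split => //; rewrite (leq_trans cR) // leq_mul2l leqnSn orbT.
- have [R' [U [sR' cR' U0 RU HU]]] := grow_subset_sums p_pr M (A :\: R) N0 HT.
  have sRA : R :|: R' \subset A.
    by rewrite subUset sR (subset_trans sR') // subsetDl.
  have dR : [disjoint R & R'].
    by move: sR'; rewrite subsetD disjoint_sym => /andP[].
  exists (R :|: R').
    split=> //; apply: (leq_trans (leq_card_setU _ _)).
    by rewrite mulnS addnC leq_add.
  have [w /andP[w0 Hw]|small] := pickP [pred w | (w != 0) && (#|U|%:R < `|set_fourier z U w| * 2)].
    right; exists w => // a b c aA bA ab abc; rewrite inE.
    apply: (almost_trivial_shift p_pr zP N0 _ Hw).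
    by apply: (HU a b) => //; rewrite -setDDl in aA bA.
  left; exists (conv_set g U).
    apply: flat_conv_set => // w w0; have := small w; rewrite /= w0 /=.
    by rewrite real_ltNge ?ger0_real ?mulr_ge0 ?ler0n // => /negbFE.
  apply: realizesU Rg RU => // u; rewrite inE => cu.
  have [v /andP[vU gv]|no] := pickP [pred v | (v \in U) && (g (u - v) != 0)].
    by exists (u - v); rewrite ?inE // opprB addrCA subrr addr0.
  case/eqP: cu; rewrite /conv_set big1 // => v vU.
  by have := no v; rewrite /= vU /= => /negbFE/eqP.
exists set0; first by split; rewrite ?sub0set ?cards0.
left; exists (fun v => (v == 0)%:R).
  have f1 w : fourier z (fun v => (v == 0)%:R) w = 1.
    rewrite /fourier (bigD1 0) //= eqxx mul1r pair_char0l big1 ?addr0 //.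
    by move=> v /negPf->; rewrite mul0r.
  split=> [|w _]; rewrite !f1 ?oner_eq0 // normr1 mul1r //.
apply: realizesS (realizes_set0 M) => //.
by apply/subsetP => v; rewrite !inE; case: (v == 0) => //; rewrite eqxx.
Qed.

Definition covers h X (M : 'M['F_p]_(h, n)) A : Prop :=
  forall a, a \in A -> exists2 x, x \in X & (a - x <= M)%MS.

(** When a subspace is replaced by the kernel of a character w, K changes the
coordinates to those of the kernel; the induction is on their number. *)
Lemma kernel_coords h (w : 'cV['F_p]_h.+1) : w != 0 ->
  exists2 K : 'M['F_p]_(h, h.+1), row_free K &
    forall c : 'rV_h.+1, c *m w = 0 -> (c <= K)%MS.
Proof.
move=> w0; have rk : \rank (kermx w) = h.
  by rewrite mxrank_ker -mxrank_tr rank_rV -trmx0 (inj_eq trmx_inj) w0 subn1.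
have resize m : m = h -> forall L : 'M['F_p]_(m, h.+1), row_free L ->
    exists2 K : 'M['F_p]_(h, h.+1), row_free K & (L <= K)%MS.
  by move=> -> L fL; exists L.
have [K fK sK] := resize _ rk _ (row_base_free (kermx w)).
exists K => // c /sub_kermxP cw.
by rewrite (submx_trans _ sK) // eq_row_base.
Qed.

(** Induction on the dimension h of the current subspace. Each step either fills
a coset of it, or passes to the kernel of a character that takes at most kappa
values on the differences, so that the number of cosets met is multiplied by at
most kappa. In dimension 0 the cosets are points, and there are too few of them
to contain A. *)
Lemma coset_in_subset_sums h (M : 'M_(h, n)) N m T t kappa A X : row_free M ->
    (0 < m <= p)%N -> (8 * m <= N)%N -> (4 * p <= kappa * m)%N ->
    (N ^ T * p ^ h < N.+1 ^ T)%N -> (p ^ h <= 2 ^ t)%N ->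
    covers X M A -> (#|X| * kappa ^ h + 2 * T * t * h < #|A|)%N ->
  exists h' (M' : 'M_(h', n)) R X', 
    [/\ (0 < h')%N, row_free M', (M' <= M)%MS, R \subset A & (#|R| <= 2 * T * t * h)%N] /\
    [/\ realizes R M' setT, covers X' M' (A :\: R) & (#|X'| <= #|X| * kappa ^ h)%N].
Proof.
move=> fM m0p mN km HT Ht; have p0 := prime_gt0 p_pr.
have k0 : (0 < kappa)%N by case: kappa km => //; rewrite mul0n leqn0 muln_eq0 /= -leqn0 leqNgt p0.
elim: h M A X fM HT Ht => [|h IH] M A X fM HT Ht cov cA.
  have: (#|A| <= #|X|)%N.
    apply/subset_leq_card/subsetP => a /cov[x xX].
    by case/submxP=> D; rewrite [D]thinmx0 mul0mx => /subr0_eq->.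
  by move: cA; rewrite expn0 muln1 muln0 addn0 ltnNge => /negP.
have [R [sR cR] [Rfull|[w w0 [K [K0 cK] HK]]]] := cover_or_character M A m0p mN HT Ht.
  exists h.+1, M, R, X; split; split => //.
  - by apply: leq_trans cR _; rewrite leq_pmulr.
  - by move=> a /setDP[/cov].
  - by rewrite leq_pmulr // expn_gt0 k0.
have [L fL kerL] := kernel_coords w0.
have [c1 c1w] : exists c1 : 'rV['F_p]_h.+1, (c1 *m w) 0 0 = 1.
  have [j wj] : exists j, w j 0 != 0.
    by apply/existsP; rewrite -negb_forall; apply: contra w0 => /forallP H;
       apply/eqP/colP => j; rewrite mxE; apply/eqP.
  by exists ((w j 0)^-1 *: delta_mx 0 j); rewrite -scalemxAl -rowE !mxE mulVf.
(* The cosets of the kernel inside x + H are reached from a fixed element of A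
   in x + H, moving along c1 by the possible values of the character. *)
pose rep x := odflt 0 [pick a in A :\: R | (a - x <= M)%MS].
pose X1 := [set rep x + (k *: c1) *m M | x in X, k in K].
have cX1 : (#|X1| <= #|X| * kappa)%N.
  rewrite /X1 curry_imset2X; apply: leq_trans (leq_imset_card _ _) _.
  rewrite cardsX leq_mul2l.
  apply/orP; right; rewrite -(leq_pmul2r (_ : 0 < m)%N); last by case/andP: m0p.
  exact: leq_trans cK km.
have cov1 : covers X1 (L *m M) (A :\: R).
  move=> a aA; have /setDP[/cov[x xX ax] _] := aA.
  have [repA repx] : rep x \in A :\: R /\ (rep x - x <= M)%MS.
    rewrite /rep; case: pickP => [b /andP[] //|/(_ a)]; by rewrite /= aA ax.
  have /submxP[c ac] : (a - rep x <= M)%MS.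
    have -> : a - rep x = (a - x) - (rep x - x) by rewrite opprB addrA subrK.
    by rewrite addmx_sub // eqmx_opp.
  have kK : (c *m w) 0 0 \in K.
    have [E|E] := eqVneq (rep x) a; last by apply: HK ac.
    have -> : c = 0; last by rewrite mul0mx mxE.
    by apply: (row_free_inj fM); rewrite mul0mx -ac E subrr.
  exists (rep x + ((c *m w) 0 0 *: c1) *m M); first by apply/imset2P; exists x ((c *m w) 0 0).
  rewrite opprD addrA ac -mulmxBl submxMr // kerL //.
  apply/matrixP => i j; rewrite !ord1 mulmxBl -scalemxAl.
  by rewrite mxE [X in _ + X]mxE [X in - X]mxE c1w mulr1 subrr mxE.
have fLM : row_free (L *m M) by rewrite /row_free mxrankMfree.
have HT1 : (N ^ T * p ^ h < N.+1 ^ T)%N.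
  by apply: leq_ltn_trans HT; rewrite leq_mul2l leq_exp2l ?prime_gt1 // leqnSn orbT.
have Ht1 : (p ^ h <= 2 ^ t)%N.
  by apply: leq_trans Ht; rewrite leq_exp2l ?prime_gt1.
have cXk : (#|X1| * kappa ^ h <= #|X| * kappa ^ h.+1)%N.
  by rewrite expnS mulnA leq_mul2r cX1 orbT.
have cD : (#|A| = #|R| + #|A :\: R|)%N by rewrite -[LHS](cardsID R) (setIidPr sR).
have cA1 : (#|X1| * kappa ^ h + 2 * T * t * h < #|A :\: R|)%N.
  by move: cA; rewrite cD; move: cXk cR; rewrite (mulnS _ h); lia.
have [h' [M' [R' [X' [[h'0 fM' sM' sR' cR'] [rM' cov' cX']]]]]] := IH _ _ _ fLM HT1 Ht1 cov1 cA1.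
exists h', M', (R :|: R'), X'; split; split => //.
- exact: submx_trans sM' (submxMl _ _).
- by rewrite subUset sR (subset_trans sR') // subsetDl.
- by apply: leq_trans (leq_card_setU _ _) _; rewrite mulnS leq_add.
- by apply: realizesS rM' => //; apply: subsetUr.
- by rewrite -setDDl.
- exact: leq_trans cX' cXk.
Qed.

End CosetSearch.

(** * Missed subset sums and coefficients *)

Section PrimeFieldSums.
Variables (p : nat) (p_pr : prime p) (I : finType).
Local Notation F := 'F_p.

(** Each new nonzero term enlarges the set of subset sums, unless that set is
stable under a nonzero translation and hence already full. *)
Lemma subset_sums_Fp (f : I -> F) (D : {set I}) y :
    (forall i, i \in D -> f i != 0) -> (p.-1 <= #|D|)%N ->
  exists2 C : {set I}, C \subset D & \sum_(i in C) f i = y.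
Proof.
move=> f0 cD.
pose S (D : {set I}) := [set \sum_(i in C) f i | C : {set I} in powerset D].
suff cS : (minn p #|D|.+1 <= #|S D|)%N.
  have : y \in S D.
    suff -> : S D = setT by rewrite inE.
    apply/eqP; rewrite eqEcard subsetT cardsT card_Fp //=; apply: leq_trans cS.
    by rewrite leq_min leqnn /=; have := prime_gt0 p_pr; lia.
  by move=> /imsetP[C]; rewrite inE => sC ->; exists C.
elim: {D cD}_.+1 {-2}D (ltnSn #|D|) f0 => // n IH D cD f0.
have [->|/set0Pn[d dD]] := eqVneq D set0.
  rewrite cards0 (leq_trans (geq_minr _ _)) // card_gt0; apply/set0Pn; exists 0.
  by apply/imsetP; exists set0; rewrite ?inE ?sub0set ?big_set0.
pose D' := D :\ d.
have cD' : #|D| = #|D'|.+1 by rewrite (cardsD1 d) dD.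
have IH' : (minn p #|D'|.+1 <= #|S D'|)%N.
  by apply: IH; [rewrite -ltnS -cD' | move=> i /setD1P[_ /f0]].
have sD' x : x \in S D' -> x \in S D.
  move=> /imsetP[C]; rewrite inE => sC ->; apply/imsetP; exists C => //.
  by rewrite inE (subset_trans sC) // subsetDl.
have sD'' x : x \in S D' -> x + f d \in S D.
  move=> /imsetP[C]; rewrite inE => sC ->; apply/imsetP; exists (d |: C).
    by rewrite inE subUset sub1set dD (subset_trans sC) // subsetDl.
  rewrite big_setU1 /=; first by rewrite addrC.
  by apply/negP => /(subsetP sC); rewrite !inE eqxx.
have [H|] := boolP [forall x in S D', x + f d \in S D'].
  have all x : x \in S D'.
    have {}H m : m%:R * f d \in S D'.
      elim: m => [|m IHm].
        by apply/imsetP; exists set0; rewrite ?inE ?sub0set ?big_set0 ?mul0r.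
      by rewrite -natr1 mulrDl mul1r; apply: (forall_inP H).
    by have := H (x / f d); rewrite natr_Zp divfK // f0.
  apply: (leq_trans (geq_minl _ _)).
  rewrite (_ : S D = setT) ?cardsT ?card_Fp //.
  by apply/setP=> x; rewrite inE sD' ?all.
rewrite negb_forall_in => /exists_inP[x xS xN].
have : (#|S D'| < #|S D|)%N.
  apply: proper_card; apply/properP; split; first by apply/subsetP.
  by exists (x + f d) => //; apply: sD''.
by rewrite cD'; move: IH'; rewrite !geq_min; lia.
Qed.

Definition bicoef (r : {poly {poly F}}) i j : F := r`_j`_i.

(** Modulo the p-th powers of the two variables, r has order at least n, and f
is its homogeneous part of degree n, dehomogenized by setting the second
variable to 1. *)
Definition lead_form (n : nat) (r : {poly {poly F}}) (f : {poly F}) : Prop :=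
  forall i j, (i < p)%N -> (j < p)%N -> (i + j <= n)%N ->
    bicoef r i j = if (i + j == n)%N then f`_i else 0.

Lemma bicoefM r s i j : bicoef (r * s) i j =
  \sum_(i1 < i.+1) \sum_(j1 < j.+1) bicoef r i1 j1 * bicoef s (i - i1) (j - j1).
Proof.
rewrite /bicoef coefM coef_sum exchange_big /=.
by apply: eq_bigr => j1 _; rewrite coefM.
Qed.

Lemma lead_formM n m r s (f g : {poly F}) : (size f <= n.+1)%N -> (size g <= m.+1)%N ->
  lead_form n r f -> lead_form m s g -> lead_form (n + m) (r * s) (f * g).
Proof.
move=> sf sg rf rg i j ip jp ij; rewrite bicoefM.
have small (i1 : 'I_i.+1) (j1 : 'I_j.+1) : (i1 + j1 != n)%N || (i + j != n + m)%N ->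
    bicoef r i1 j1 * bicoef s (i - i1) (j - j1) = 0.
  move=> H; have i1i := ltn_ord i1; have j1j := ltn_ord j1.
  have [L|L] := ltnP (i1 + j1) n.
    by rewrite rf ?ltn_eqF ?mul0r //; lia.
  have L2 : (i - i1 + (j - j1) < m)%N by lia.
  by rewrite [bicoef s _ _]rg ?ltn_eqF ?mulr0 //; lia.
have [E|NE] := eqVneq (i + j)%N (n + m)%N; last first.
  by rewrite big1 // => i1 _; rewrite big1 // => j1 _; rewrite small // NE orbT.
rewrite coefM; apply: eq_bigr => i1 _.
have i1i := ltn_ord i1.
have [L|L] := ltnP n i1.
  rewrite big1 ?[f`_i1]nth_default ?mul0r //; first exact: leq_trans sf L.
  by move=> j1 _; rewrite small //; have := ltn_ord j1; lia.
have [L'|L'] := ltnP m (i - i1).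
  rewrite big1 ?[g`__]nth_default ?mulr0 //; first exact: leq_trans sg L'.
  by move=> j1 _; rewrite small //; have := ltn_ord j1; lia.
have j1P : (n - i1 < j.+1)%N by lia.
rewrite (bigD1 (Ordinal j1P)) //= big1 ?addr0; last first.
  move=> j1 /negP nj; rewrite small //; apply/orP; left; apply/negP => /eqP e; case: nj.
  by apply/eqP/val_inj => /=; lia.
rewrite rf; [|lia..]; rewrite rg; [|lia..].
rewrite (_ : (i1 + (n - i1) == n)%N); last by apply/eqP; lia.
by rewrite (_ : (i - i1 + (j - (n - i1)) == m)%N) //; apply/eqP; lia.
Qed.

(** The element (a, b) of the group ring of the plane, written in the nilpotent
variables obtained by subtracting 1 from the two generators. *)
Definition mono a b : {poly {poly F}} := ((1 + 'X) ^+ a)%:P * (1 + 'X) ^+ b.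

Lemma coef_1DXn (R : comNzRingType) n i : ((1 + 'X : {poly R}) ^+ n)`_i = ('C(n, i))%:R.
Proof.
elim: n i => [|n IH] i; first by rewrite expr0 coef1 bin0n.
rewrite exprS mulrDl mul1r coefD coefXM !IH; case: i => [|i] /=.
  by rewrite addr0 !bin0.
by rewrite binS natrD.
Qed.

Lemma bicoef_mono a b i j : bicoef (mono a b) i j = 'C(a, i)%:R * 'C(b, j)%:R.
Proof.
have cn (q : {poly F}) n : (q * n%:R)`_i = q`_i * n%:R.
  by rewrite mulr_natr coefMn mulr_natr.
by rewrite /bicoef coefCM coef_1DXn cn coef_1DXn.
Qed.

Lemma monoM a b c d : mono a b * mono c d = mono (a + c) (b + d).
Proof. by rewrite /mono !exprD polyCM mulrACA. Qed.

Definition lin_form (ab : F * F) : {poly F} := ab.1 *: 'X + (ab.2)%:P.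

Lemma size_lin_form ab : (size (lin_form ab) <= 2)%N.
Proof.
rewrite (leq_trans (size_polyD _ _)) // geq_max (leq_trans (size_scale_leq _ _)) ?size_polyX //.
by rewrite (leq_trans (size_polyC_leq1 _)).
Qed.

Lemma lead_form_mono a b : lead_form 0 (mono a b) 1.
Proof.
move=> i j _ _; rewrite leqn0 addn_eq0 => /andP[/eqP-> /eqP->].
by rewrite bicoef_mono !bin0 mulr1 eqxx coef1.
Qed.

(** Exponents are residues read as natural numbers, so the linear part of a
group element minus 1 has the residues themselves as coefficients. *)
Lemma lead_form_mono_sub1 (ab : F * F) :
  lead_form 1 (mono ab.1 ab.2 - 1) (lin_form ab).
Proof.
move=> i j _ _.
rewrite /bicoef !coefB -/(bicoef _ i j) bicoef_mono coef1.
case: i j => [|[|i]] [|[|j]] //= _.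
- by rewrite coef1 !bin0 mulr1 subrr.
- by rewrite coef0 /lin_form coefD coefZ coefX coefC bin0 bin1 mul1r subr0 mulr0 add0r natr_Zp.
- by rewrite /lin_form coefD coefZ coefX coefC coef1 subr0 bin0 bin1 !mulr1 natr_Zp addr0.
Qed.

(** The falling factorial a (a - 1) ... (a - p + 2) skips only one residue class, so
it contains a multiple of p unless a is congruent to -1. In this way the
coefficient of degree p - 1 of (1 + X)^a detects a residue class of a. *)
Lemma bin_Fp_eq0 a : a%:R != -1 :> F -> 'C(a, p.-1)%:R = 0 :> F.
Proof.
move=> aN1; have p0 := prime_gt0 p_pr.
have fN0 : (p.-1)`!%:R != 0 :> F.
  have /dvdnP[k E] : (p %| (p.-1)`!.+1)%N by rewrite -Wilson ?prime_gt1.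
  apply/eqP => f0; have : (p.-1)`!.+1%:R = 0 :> F by rewrite E natrM pchar_Fp_0 // mulr0.
  by rewrite -natr1 f0 add0r => /eqP; rewrite oner_eq0.
apply: (mulIf fN0); rewrite mul0r -natrM bin_ffact ffact_prod natr_prod.
have rp : (a %% p < p)%N by rewrite ltn_mod.
have rN : (a %% p)%N != p.-1.
  apply: contra aN1 => /eqP E.
  rewrite -(Fp_nat_mod p_pr) E -addr_eq0 natr1 prednK //.
  by rewrite pchar_Fp_0.
have rP : (a %% p < p.-1)%N by lia.
rewrite (bigD1 (Ordinal rP)) //= {1}(divn_eq a p) addnK natrM pchar_Fp_0 //.
by rewrite mulr0 mul0r.
Qed.

(** Consider the product of the group ring elements (group element of i) - 1
over D. Its leading form is the product of the linear forms, of degree 2 (p -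
1), the largest degree not killed by the p-th powers. Expanded instead, the
product is a signed sum of the group elements of all the subset sums. After a
shift that moves (y, z) to (-1, -1), the coefficient of top degree vanishes on
every group element other than the missed one. *)
Lemma missed_sum_coef0 (ab : I -> F * F) (y z : F) (D : {set I}) :
    #|D| = (p.-1).*2 ->
    (forall C : {set I}, C \subset D ->
      (\sum_(i in C) (ab i).1, \sum_(i in C) (ab i).2) != (y, z)) ->
  (\prod_(i in D) lin_form (ab i))`_(p.-1) = 0.
Proof.
move=> cD miss; have p0 := prime_gt0 p_pr.
pose Q (D : {set I}) := \prod_(i in D) (mono (ab i).1 (ab i).2 - 1).
have lQ : lead_form #|D| (Q D) (\prod_(i in D) lin_form (ab i)) /\
          (size (\prod_(i in D) lin_form (ab i))%R <= #|D|.+1)%N.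
  rewrite -sum1_card; apply: (big_rec3 (fun f r n => lead_form n r f /\ (size f <= n.+1)%N)).
    by rewrite size_poly1; split=> //; have := lead_form_mono 0 0; rewrite /mono !expr0 mulr1.
  move=> i f r n _ [lr sf]; split.
    by apply: lead_formM => //; [apply: size_lin_form | apply: lead_form_mono_sub1].
  apply: leq_trans (size_polyMleq _ _) _.
  by have := size_lin_form (ab i); lia.
pose u : F := - 1 - y; pose v : F := - 1 - z.
have vanish : bicoef (Q D * mono u v) p.-1 p.-1 = 0.
  have : forall C : {set I}, C \subset D ->
     (u%:R + \sum_(i in C) (ab i).1 != -1) ||
     (v%:R + \sum_(i in C) (ab i).2 != -1).
    move=> C /miss; apply: contraR; rewrite negb_or !negbK => /andP[/eqP E1 /eqP E2].
    rewrite !natr_Zp in E1 E2; apply/eqP; congr pair.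
      by rewrite -[LHS](addKr u) E1 /u; ring.
    by rewrite -[LHS](addKr v) E2 /v; ring.
  move: (nat_of_ord u) (nat_of_ord v).
  elim: {D cD miss lQ}#|D| {-2}D (erefl #|D|) => [|n IH] D cD a b H.
    rewrite (cards0_eq cD) /Q big_set0 mul1r bicoef_mono.
    have := H set0 (sub0set _); rewrite !big_set0 !addr0.
    by case/orP=> /bin_Fp_eq0 ->; rewrite ?mul0r ?mulr0.
  have [d dD] : exists d, d \in D by apply/set0Pn; rewrite -cards_eq0 cD.
  have cD' : #|D :\ d| = n by move: cD; rewrite (cardsD1 d) dD => -[].
  rewrite /Q (big_setD1 d) //= -/(Q _) mulrAC mulrBl mul1r mulrBl monoM.
  rewrite mulrC [mono a b * _]mulrC /bicoef !coefB -!/(bicoef _ _ _).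
  rewrite !IH ?subrr // => C sC.
    by apply: H; rewrite (subset_trans sC) // subsetDl.
  have dC : d \notin C by apply/negP => /(subsetP sC); rewrite !inE eqxx.
  have := H (d |: C); rewrite !big_setU1 //= !natrD !natr_Zp !addrA ![_%:R + (ab d).1]addrC ![_%:R + (ab d).2]addrC.
  by apply; rewrite subUset sub1set dD (subset_trans sC) // subsetDl.
have := lead_formM lQ.2 _ lQ.1 (lead_form_mono u v).
rewrite addn0 mulr1 cD => /(_ _ p.-1 p.-1); rewrite vanish.
rewrite addnn eqxx => <- //; first by rewrite size_poly1.
all: by rewrite prednK.
Qed.

End PrimeFieldSums.

(** * Products of linear forms without a gap *)

Section Wronskian.
Variables (p : nat) (p_pr : prime p).
Local Notation F := 'F_p.
Implicit Types (P Q f : {poly F}).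

Lemma coefM_top (R : nzRingType) (A B : {poly R}) a b :
  (size A <= a.+1)%N -> (size B <= b.+1)%N -> (A * B)`_(a + b) = A`_a * B`_b.
Proof.
move=> sA sB; rewrite coefM.
have aP : (a < (a + b).+1)%N by lia.
rewrite (bigD1 (Ordinal aP)) //= addKn big1 ?addr0 // => i /negP ia.
have [L|L] := ltnP a i.
  by rewrite [A`_i]nth_default ?mul0r // (leq_trans sA).
rewrite [B`__]nth_default ?mulr0 //; apply: leq_trans sB _.
have : nat_of_ord i != a by apply/negP => /eqP E; apply: ia; apply/eqP/val_inj.
by have := ltn_ord i; lia.
Qed.

(** Below degree p, the vanishing of the Wronskian works as in characteristic
zero: the leading terms force equal degrees, so subtracting the multiple of P
that kills the top coefficient of Q must leave 0. *)
Lemma wronskian0_colinear P Q : P != 0 -> (size P <= p)%N -> (size Q <= p)%N ->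
  Q * P^`() = Q^`() * P -> exists c, Q = c *: P.
Proof.
move=> P0 sP sQ W.
pose d := (size P).-1; have sPd : size P = d.+1 by apply: polySpred.
have Pd0 : P`_d != 0 by rewrite -/(lead_coef P) lead_coef_eq0.
pose c := Q`_d / P`_d; exists c; apply/eqP; rewrite -subr_eq0.
set Q1 := Q - c *: P.
have W1 : Q1 * P^`() = Q1^`() * P.
  by rewrite /Q1 derivB derivZ mulrBl mulrBl W -!scalerAl [P * _]mulrC.
have Q1d : Q1`_d = 0 by rewrite coefB coefZ divfK ?subrr.
have sQ1 : (size Q1 <= p)%N.
  rewrite (leq_trans (size_polyD _ _)) // geq_max sQ size_polyN.
  by rewrite (leq_trans (size_scale_leq _ _)).
apply/negPn/negP => Q10.
pose e := (size Q1).-1; have sQe : size Q1 = e.+1 by apply: polySpred.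
have Q1e0 : Q1`_e != 0 by rewrite -/(lead_coef Q1) lead_coef_eq0.
(* The extra factor X turns differentiation into multiplication of each
   coefficient by its index, which avoids a special case for constants. *)
have XW : Q1 * ('X * P^`()) = ('X * Q1^`()) * P.
  by rewrite mulrCA W1 mulrA.
have coefXd (A : {poly F}) i : ('X * A^`())`_i = A`_i *+ i.
  by rewrite coefXM; case: i => [|i] //=; rewrite coef_deriv.
have sXd (A : {poly F}) i : (size A <= i.+1)%N -> (size ('X * A^`())%R <= i.+1)%N.
  move=> sA; apply/leq_sizeP => j ij; rewrite coefXd nth_default ?mul0rn //.
  exact: leq_trans sA ij.
have := congr1 (fun A : {poly F} => A`_(e + d)) XW.
rewrite !coefM_top ?sXd ?sPd ?sQe // !coefXd mulrnAr mulrnAl => /eqP.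
rewrite -[X in X == _]mulr_natr -[X in _ == X]mulr_natr (inj_eq (mulfI _)) ?mulf_neq0 //.
rewrite -(inj_eq val_inj) /= !val_Fp_nat // !modn_small; [|lia..].
by move=> /eqP E; move: Q1e0; rewrite -E Q1d eqxx.
Qed.

Variable I : finType.
Implicit Types (E : {set I}) (ab : I -> F * F).

Definition form_root (x : F * F) : F := - x.2 / x.1.

Lemma lin_form_root (x : F * F) : x.1 != 0 -> lin_form x = x.1 *: ('X - (form_root x)%:P).
Proof.
move=> x0; have E : x.1 * form_root x = - x.2 by rewrite mulrC divfK.
by rewrite /lin_form scalerBr -!mul_polyC -polyCM E polyCN opprK.
Qed.

(** Differentiating lowers each multiplicity by at most one, and the simple
product restores it. *)
Lemma dvdp_deriv_prod (r : seq F) (m : F -> nat) :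
  \prod_(x <- r) ('X - x%:P) ^+ m x %|
  (\prod_(x <- r) ('X - x%:P) ^+ m x)^`() * \prod_(x <- r) ('X - x%:P).
Proof.
elim: r => [|x r IH]; first by rewrite !big_nil dvd1p.
rewrite !big_cons derivM; set B := \prod_(j <- r) _ in IH *.
set e := \prod_(j <- r) _ in IH *.
rewrite mulrDl dvdp_add //.
  case: (m x) => [|k]; first by rewrite expr0 derivE !mul0r dvdp0.
  rewrite deriv_exp derivXsubC mul1r -mulr_natr /=; set q := 'X - _; set N := _%:R.
  have -> : q ^+ k * N * B * (q * e) = q ^+ k.+1 * B * (N * e) by rewrite exprS; ring.
  exact: dvdp_mulr.
set A := (_ - _) ^+ _; set q := _ - _.
have -> : A * B^`() * (q * e) = A * (B^`() * e) * q by ring.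
by rewrite dvdp_mulr // dvdp_mul.
Qed.

Lemma mup_prod_XsubC E (g : I -> F) (r : F) :
  mup r (\prod_(i in E) ('X - (g i)%:P)) = #|[set i in E | g i == r]|.
Proof.
rewrite -sum1dep_card [RHS]big_mkcondr /=.
suff [//] : mup r (\prod_(i in E) ('X - (g i)%:P)) = \sum_(i in E) (if g i == r then 1 else 0)%N
     /\ \prod_(i in E) ('X - (g i)%:P) != 0.
apply: (big_rec2 (fun A k => mup r A = k /\ A != 0)).
  by split; rewrite ?oner_eq0 // mupNroot // root1.
move=> i k A _ [<- A0].
have X0 : 'X - (g i)%:P != 0 by rewrite polyXsubC_eq0.
by split; rewrite ?mulf_neq0 // mupM // -[in mup _ ('X - _)](expr1 ('X - _)) mup_XsubCX.
Qed.

Definition on_line ab E (l m : F) : {set I} :=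
  [set i in E | l * (ab i).1 + m * (ab i).2 == 0].

Definition form_roots ab E : {set F} :=
  [set form_root (ab i) | i in [set i in E | (ab i).1 != 0]].

(** If all the coefficients of index p - 1 - s, ..., p - 1 were zero, then f =
X^p P + Q with Q of size at most p - 1 - s. The derivative of X^p is 0, so P and
Q have the same Wronskian as P and f, and it is divisible by f with every
multiplicity lowered by one. As f has at most s roots, this divisor is larger
than the Wronskian, which therefore vanishes; then X + a divides f at least p
times for some a, although every direction occurs less than p times. *)
Lemma no_coef_gap ab s E :
    #|E| = (p.-1.*2 - s)%N -> (s < p)%N ->
    (forall i, i \in E -> ab i != 0) ->
    (forall l m : F, (l, m) != 0 -> (#|on_line ab E l m| < p)%N) ->
    (#|form_roots ab E| <= s)%N ->
  exists2 j, (j <= s)%N & (\prod_(i in E) lin_form (ab i))`_(p.-1 - j) != 0.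
Proof.
move=> cE sp ab0 dirs cR; set f := \prod_(i in E) _.
have p0 := prime_gt0 p_pr; have p1 := prime_gt1 p_pr.
have [j /= fj|gap] := pickP (fun j : 'I_s.+1 => f`_(p.-1 - j) != 0).
  by exists j => //; rewrite -ltnS.
exfalso.
pose E0 := [set i in E | (ab i).1 != 0].
pose r i := form_root (ab i).
pose Om := [set r i | i in E0].
pose h := \prod_(i in E0) ('X - (r i)%:P).
have [c c0 fh] : exists2 c, c != 0 & f = c *: h.
  exists ((\prod_(i in E | (ab i).1 != 0) (ab i).1) * (\prod_(i in E | (ab i).1 == 0) (ab i).2)).
    rewrite mulf_neq0 // prodf_seq_neq0; apply/allP => i _; apply/implyP => /andP[iE] //.
    move=> /eqP a0; apply: contra (ab0 i iE) => /eqP b0.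
    by rewrite [ab i]surjective_pairing a0 b0.
  rewrite /f (bigID (fun i => (ab i).1 != 0)) /=.
  rewrite (eq_bigr (fun i => (ab i).1%:P * ('X - (r i)%:P))); last first.
    by move=> i /andP[_ a0]; rewrite lin_form_root // mul_polyC.
  rewrite [X in _ * X](eq_bigr (fun i => (ab i).2%:P)); last first.
    by move=> i /andP[_ /negPn/eqP a0]; rewrite /lin_form a0 scale0r add0r.
  rewrite big_split /= -!(rmorph_prod (@polyC F)) /= mulrAC -polyCM mul_polyC; congr (_ * _ *: _).
    by apply: eq_bigl => i; rewrite negbK.
  by apply: eq_bigl => i; rewrite inE.
have sh : size h = #|E0|.+1.
  by rewrite /h -big_enum size_prod_XsubC -cardE.
have sf : size f = #|E0|.+1 by rewrite fh size_scale.
have cE0 : (#|E| < #|E0| + p)%N.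
  have n10 : ((1, 0) : F * F) != 0 by apply/eqP => -[] /eqP; rewrite oner_eq0.
  have := dirs 1 0 n10.
  rewrite -(cardsID E0 E) (setIidPr _) ?ltn_add2l; last first.
    by apply/subsetP=> i; rewrite inE => /andP[].
  apply: leq_trans; rewrite ltnS subset_leq_card //; apply/subsetP => i.
  by rewrite !inE mul1r mul0r addr0 => /andP[]; case: (i \in E) => //=; rewrite negbK.
pose P := drop_poly p f; pose Q := take_poly p f.
have fPQ : f = Q + P * 'X^p by rewrite poly_take_drop.
have sQ : (size Q <= p.-1 - s)%N.
  apply/leq_sizeP => j jp; rewrite coef_take_poly; case: ltnP => // jlt.
  have jP : (p.-1 - j < s.+1)%N by lia.
  have := gap (Ordinal jP) => /= /negbFE/eqP.
  by rewrite subKn; [|lia].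
have sP : (size P <= #|E0|.+1 - p)%N by rewrite /P size_drop_poly sf.
have dXp : ('X^p)^`() = 0 :> {poly F}.
  by rewrite derivXn -mulr_natr -polyC_natr pchar_Fp_0 // polyC0 mulr0.
have df : f^`() = Q^`() + P^`() * 'X^p.
  by rewrite [in LHS]fPQ derivD derivM dXp mulr0 addr0.
have P0 : P != 0.
  apply/eqP => P0; move: sf; rewrite fPQ P0 mul0r addr0 => sf'.
  by move: sQ; rewrite sf'; lia.
have sPp : (size P <= p)%N.
  apply: leq_trans sP _; have : (#|E0| <= #|E|)%N by apply/subset_leq_card/subsetP=> i; rewrite inE => /andP[].
  by lia.
have sQp : (size Q <= p)%N by apply: leq_trans sQ _; lia.
pose g := \prod_(x <- enum Om) ('X - x%:P) ^+ (#|[set i in E0 | r i == x]|.-1).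
pose e := \prod_(x <- enum Om) ('X - x%:P).
have hge : h = g * e.
  rewrite /h (partition_big_imset r) /= /g /e -big_split /= big_enum /=.
  apply: eq_bigr => x /imsetP[i iE0 ->].
  rewrite (eq_bigr (fun _ => 'X - (r i)%:P)); last by move=> j /andP[_ /eqP->].
  rewrite (eq_bigl (mem [set j in E0 | r j == r i])); last by move=> j; rewrite !inE.
  rewrite prodr_const -exprSr prednK // card_gt0; apply/set0Pn; exists i.
  by rewrite inE iE0 eqxx.
have h0 : h != 0 by rewrite -size_poly_eq0 sh.
have /andP[g0 e0] : (g != 0) && (e != 0) by move: h0; rewrite hge mulf_eq0 negb_or.
have se : size e = #|Om|.+1 by rewrite /e size_prod_XsubC -cardE.
have sg : (size g + #|Om| = #|E0|.+1)%N.
  by rewrite -sh hge size_mul // se addnS.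
have gf : g %| f by rewrite fh dvdpZr // hge dvdp_mulr.
have gf' : g %| f^`().
  rewrite fh derivZ dvdpZr // hge derivM dvdp_add //; last exact: dvdp_mulr.
  exact: dvdp_deriv_prod.
have W : Q * P^`() = Q^`() * P.
  apply/eqP; rewrite -subr_eq0; set w := _ - _.
  have gw : g %| w.
    have -> : w = f * P^`() - f^`() * P.
      by rewrite df fPQ /w; ring.
    by rewrite dvdp_sub ?dvdp_mulr.
  apply/negPn/negP => w0.
  have := dvdp_leq w0 gw; rewrite leqNgt => /negP; apply.
  have cRO : (#|Om| <= s)%N by [].
  have lP : (0 < size P)%N by rewrite lt0n size_poly_eq0.
  have dP : (size P^`() < size P)%N by rewrite lt_size_deriv.
  have sw : (size w <= (size Q + size P).-2)%N.
    rewrite (leq_trans (size_polyD _ _)) // size_polyN geq_max.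
    have [->|Q0] := eqVneq Q 0; first by rewrite deriv0 !mul0r size_poly0.
    have dQ : (size Q^`() < size Q)%N by rewrite lt_size_deriv.
    have le2 x y u v : (x <= u -> y < v -> (x + y).-1 <= (u + v).-2)%N by clear; lia.
    apply/andP; split; apply: leq_trans (size_polyMleq _ _) _; first exact: le2.
    by rewrite [X in X.-1]addnC [X in X.-2]addnC le2.
  apply: leq_ltn_trans sw _.
  move: sg sQ sP lP cRO cE0; rewrite cE; move: (size g) (size Q) (size P) #|Om| #|E0|; clear -sp p0; lia.
have [a Qa] := wronskian0_colinear P0 sPp sQp W.
(* Here X^p + a = (X + a)^p, because a^p = a. *)
have fX : f = ('X - (- a)%:P) ^+ p * P.
  have pP : p \in [pchar {poly F}] by rewrite pchar_poly pchar_Fp.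
  rewrite fPQ Qa polyCN opprK exprDn_pchar ?pnatE //.
  have ap : a ^+ p = a by rewrite -[RHS]expf_card card_Fp.
  rewrite -polyC_exp ap mulrDl mul_polyC addrC; congr (_ + _).
  exact: mulrC.
have f0 : f != 0 by rewrite -size_poly_eq0 sf.
have : (p <= mup (- a) f)%N by rewrite mup_geq // fX dvdp_mulr.
rewrite fh -mul_polyC mupMr; last by rewrite rootC.
rewrite mup_prod_XsubC leqNgt => /negP; apply.
have na1 : ((- a, 1) : F * F) != 0 by apply/eqP => -[] _ /eqP; rewrite oner_eq0.
have := dirs (- a) 1 na1.
apply: leq_ltn_trans; apply/subset_leq_card/subsetP => i.
rewrite !inE => /andP[/andP[-> a0] /eqP <-] /=.
by rewrite /r /form_root mul1r mulrAC -mulrA divff // mulr1 addNr.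
Qed.

End Wronskian.

(** * Subset sums in the plane *)

Section PlaneSums.
Variables (p : nat) (p_pr : prime p) (I : finType) (ab : I -> 'F_p * 'F_p).
Local Notation F := 'F_p.
Implicit Types (E B : {set I}) (ps : seq (I * I)).

Lemma form_basis_span (x y : F * F) : x.1 * y.2 - x.2 * y.1 != 0 ->
  forall k (g : {poly F}), (size g <= k.+2)%N ->
  exists u v : {poly F}, [/\ (size u <= k.+1)%N, (size v <= k.+1)%N &
    g = u * lin_form x + v * lin_form y].
Proof.
set D := _ - _ => D0 k g sg.
pose g0 := take_poly 1 g; pose g1 := drop_poly 1 g.
have gE : g = g0 + g1 * 'X by rewrite -['X]expr1 poly_take_drop.
have sg0 : (size g0 <= k.+1)%N by rewrite (leq_trans (size_take_poly _ _)).
have sg1 : (size g1 <= k.+1)%N by rewrite size_drop_poly; lia.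
have sz (c d : F) : (size (c *: g0 + d *: g1)%R <= k.+1)%N.
  by rewrite (leq_trans (size_polyD _ _)) // geq_max !(leq_trans (size_scale_leq _ _)).
exists ((- y.1 / D) *: g0 + (y.2 / D) *: g1), ((x.1 / D) *: g0 + (- x.2 / D) *: g1).
split=> //.
rewrite {1}gE /lin_form -!mul_polyC.
have DC : D%:P * (D^-1)%:P = 1 :> {poly F} by rewrite -polyCM divff.
rewrite !polyCM !polyCN; set d := (D^-1)%:P in DC *.
have -> : g0 + g1 * 'X = (D%:P * d) * (g0 + g1 * 'X) by rewrite DC mul1r.
rewrite /D polyCB !polyCM; ring.
Qed.

Definition indep (i j : I) := (ab i).1 * (ab j).2 - (ab i).2 * (ab j).1 != 0.

(** The two members of a pair, and all the later pairs, avoid E and each other,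
so that one member of each pair can be added to E in every possible way. *)
Fixpoint exchange_pairs B E ps : bool :=
  if ps is (i, j) :: ps' then
    [&& i \in B, j \in B, i \notin E, j \notin E, indep i j &
        exchange_pairs B (i |: (j |: E)) ps']
  else true.

Lemma exchange_pairsS B E E' ps : E \subset E' ->
  exchange_pairs B E' ps -> exchange_pairs B E ps.
Proof.
elim: ps E E' => //= -[i j] ps IH E E' sE /and5P[-> -> iE jE /andP[-> H]] /=.
rewrite (contra (subsetP sE i)) // (contra (subsetP sE j)) //=.
by apply: IH H; rewrite !setUS.
Qed.

(** The product over E and one member of each pair has a zero coefficient,
whatever members are chosen. The two forms of an independent pair span all the
linear forms, so by linearity the chosen members can be replaced by an arbitrary
polynomial g of degree at most the number of pairs. *)
Lemma coef_exchange B ps E :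
    (forall D : {set I}, D \subset B -> #|D| = p.-1.*2 ->
       (\prod_(i in D) lin_form (ab i))`_(p.-1) = 0) ->
    E \subset B -> (#|E| + size ps = p.-1.*2)%N -> exchange_pairs B E ps ->
  forall g : {poly F}, (size g <= (size ps).+1)%N ->
    ((\prod_(i in E) lin_form (ab i)) * g)`_(p.-1) = 0.
Proof.
move=> HB; elim: ps E => [|[i j] ps IH] E sE cE /=.
  move=> _ g /size1_polyC ->; rewrite coefMC HB ?mul0r //.
  by rewrite -cE addn0.
move=> /and5P[iB jB iE jE /andP[ij ok]] g sg.
have [u [v [su sv ->]]] := form_basis_span ij sg.
have step k (w : {poly F}) : k \in B -> k \notin E -> exchange_pairs B (k |: E) ps ->
    (size w <= (size ps).+1)%N ->
    ((\prod_(i in E) lin_form (ab i)) * (w * lin_form (ab k)))`_(p.-1) = 0.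
  move=> kB kE okk sw; have := IH (k |: E) _ _ okk w sw.
  rewrite big_setU1 //=; set A := \prod_(_ in E) _.
  have -> : A * (w * lin_form (ab k)) = lin_form (ab k) * A * w by ring.
  apply.
    by rewrite subUset sub1set kB.
  by rewrite cardsU1 kE -cE /= addnS.
rewrite mulrDr coefD !step ?addr0 //.
  by apply: exchange_pairsS ok; rewrite subsetUr.
by apply: exchange_pairsS ok; rewrite setUS // subsetUr.
Qed.

Lemma indep_partner B i : i \in B -> ab i != 0 -> (p <= #|B|)%N ->
    (forall l m : F, (l, m) != 0 -> (#|on_line ab B l m| < p)%N) ->
  exists2 j, j \in B & indep i j.
Proof.
move=> iB i0 cB dirs.
have n0 : (- (ab i).2, (ab i).1) != 0 :> F * F.
  apply: contra i0 => /eqP E.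
  have /= a0 : - - (ab i).2 = 0 by rewrite (congr1 fst E : - (ab i).2 = 0) oppr0.
  have /= b0 := congr1 snd E; rewrite opprK in a0.
  by rewrite [ab i]surjective_pairing a0 b0.
have /properP[_ [j jB jN]] : on_line ab B (- (ab i).2) (ab i).1 \proper B.
  rewrite properEcard (leq_trans (dirs _ _ n0)) // andbT.
  by apply/subsetP => k; rewrite inE => /andP[].
exists j => //; move: jN; rewrite inE jB /indep /=; apply: contra => /eqP E.
by rewrite addrC -E; apply/eqP; ring.
Qed.

Lemma exists_exchange_pairs B s :
    (p.-1.*2 + s <= #|B|)%N -> (s < p)%N -> (forall i, i \in B -> ab i != 0) ->
    (forall l m : F, (l, m) != 0 -> (#|on_line ab B l m| < p)%N) ->
  exists E ps, [/\ E \subset B, size ps = s, (#|E| + s.*2 = #|B|)%N & exchange_pairs B E ps].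
Proof.
move=> cB sp B0 dirs; have p1 := prime_gt1 p_pr.
elim: s cB sp => [|s IH] cB sp; first by exists B, [::]; rewrite addn0.
have [|//|E [ps [sE cps cE ok]]] := IH; [lia|lia|].
have E0 : (0 < #|E|)%N by lia.
have /set0Pn[i iE] : E != set0 by rewrite -card_gt0.
have iB := subsetP sE i iE.
have [||l m lm|j jE ij] := @indep_partner E i iE; [exact: B0 | lia | |].
  apply: leq_ltn_trans (dirs l m lm); apply/subset_leq_card/subsetP => k.
  by rewrite !inE => /andP[/(subsetP sE)-> ->].
have jB := subsetP sE j jE.
have neq : i != j by apply: contra ij => /eqP <-; rewrite subr_eq0 mulrC.
exists (E :\ i :\ j), ((i, j) :: ps); split.
- by rewrite (subset_trans _ sE) // (subset_trans (subsetDl _ _)) ?subsetDl.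
- by rewrite /= cps.
- rewrite -cE (cardsD1 i E) iE (cardsD1 j (E :\ i)) !inE eq_sym neq jE.
  by move: #|_| => n; clear; lia.
- rewrite /= iB jB !inE !eqxx andbF /= ij /= /indep.
  apply: exchange_pairsS ok; apply/subsetP => k; rewrite !inE.
  by case: eqP => [->|_] /=; [rewrite iE | case: eqP => [->|] //=; rewrite jE].
Qed.

Lemma subset_of_card (E : {set I}) k : (k <= #|E|)%N ->
  exists2 E' : {set I}, E' \subset E & #|E'| = k.
Proof.
move=> /card_geqP[r [ur sr rE]]; exists [set i in r].
  by apply/subsetP => i; rewrite inE => /rE.
by rewrite cardsE -sr; apply/card_uniqP.
Qed.

(** Taking powers of X for g in [coef_exchange] produces the gap that
[no_coef_gap] excludes. *)
Theorem thin_lines_subset_sums B s y z :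
    (s < p)%N -> (p.-1.*2 + s <= #|B|)%N -> (forall i, i \in B -> ab i != 0) ->
    (forall l m : F, (l, m) != 0 -> (#|on_line ab B l m| < p)%N) ->
    (#|form_roots ab B| <= s)%N ->
  exists2 C : {set I}, C \subset B &
    \sum_(i in C) (ab i).1 = y /\ \sum_(i in C) (ab i).2 = z.
Proof.
move=> sp cB B0 dirs cR.
have [/existsP[C /andP[sC /eqP[E1 E2]]]|no] :=
  boolP [exists C : {set I}, (C \subset B) &&
    ((\sum_(i in C) (ab i).1, \sum_(i in C) (ab i).2) == (y, z))].
  by exists C.
exfalso.
have HB (D : {set I}) : D \subset B -> #|D| = p.-1.*2 ->
    (\prod_(i in D) lin_form (ab i))`_(p.-1) = 0.
  move=> sD cD; apply: (missed_sum_coef0 p_pr (y := y) (z := z) cD) => C sC.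
  apply: contra no => H; apply/existsP; exists C.
  by rewrite (subset_trans sC sD).
have [E [ps [sE cps cE ok]]] := exists_exchange_pairs cB sp B0 dirs.
have [|E' sE' cE'] := @subset_of_card E (p.-1.*2 - s); first by lia.
have sE'B := subset_trans sE' sE.
have [|l m lm||j js] := @no_coef_gap p p_pr I ab s E' cE' sp.
- by move=> i /(subsetP sE'B)/B0.
- apply: leq_ltn_trans (dirs l m lm); apply/subset_leq_card/subsetP => k.
  by rewrite !inE => /andP[/(subsetP sE'B)-> ->].
- apply: leq_trans cR; apply/subset_leq_card/imsetS/subsetP => k.
  by rewrite !inE => /andP[/(subsetP sE'B)-> ->].
have cE'ps : (#|E'| + size ps = p.-1.*2)%N by rewrite cE' cps; lia.
have := coef_exchange HB sE'B cE'ps (exchange_pairsS sE' ok) (g := 'X^j).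
rewrite size_polyXn cps ltnS => /(_ js); rewrite coefMXn ltnNge => H; case/negP; move: H.
rewrite (leq_trans js) /=; last by lia.
by move=> ->.
Qed.

(** Elements off the line first adjust the functional phi that vanishes on it;
those on the line then adjust the complementary functional psi without changing
phi. *)
Lemma heavy_line_subset_sums B l m y z : (l, m) != 0 ->
    (forall i, i \in B -> ab i != 0) ->
    (p.-1 <= #|on_line ab B l m|)%N -> (p.-1 <= #|B :\: on_line ab B l m|)%N ->
  exists2 C : {set I}, C \subset B &
    \sum_(i in C) (ab i).1 = y /\ \sum_(i in C) (ab i).2 = z.
Proof.
move=> lm B0 on off; set L := on_line ab B l m in on off.
have sL : L \subset B by apply/subsetP => i; rewrite inE => /andP[].
pose phi (v : F * F) := l * v.1 + m * v.2.
pose psi (v : F * F) := if m != 0 then v.1 else v.2.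
have kernel0 v : phi v = 0 -> psi v = 0 -> v = 0.
  rewrite /phi /psi [v]surjective_pairing /=; case: ifPn => [m0|/negPn/eqP m0] E v0.
    by move/eqP: E; rewrite v0 mulr0 add0r mulf_eq0 (negPf m0) => /eqP->.
  move/eqP: E; rewrite v0 mulr0 addr0 mulf_eq0 => /orP[/eqP l0|/eqP->] //.
  by case/eqP: lm; rewrite l0 m0.
have phiD v w : phi (v + w) = phi v + phi w by rewrite /phi /=; ring.
have psiD v w : psi (v + w) = psi v + psi w by rewrite /psi; case: ifP.
have phi0 : phi 0 = 0 by rewrite /phi !mulr0 addr0.
have psi0 : psi 0 = 0 by rewrite /psi; case: ifP.
have phi_sum (C : {set I}) : phi (\sum_(i in C) ab i) = \sum_(i in C) phi (ab i) by apply: big_morph.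
have psi_sum (C : {set I}) : psi (\sum_(i in C) ab i) = \sum_(i in C) psi (ab i) by apply: big_morph.
have [||C1 sC1 E1] := subset_sums_Fp p_pr (f := fun i => phi (ab i)) (D := B :\: L) (phi (y, z)).
- by move=> i; rewrite !inE => /andP[H iB]; apply: contra H; rewrite iB.
- by [].
have [||C2 sC2 E2] := subset_sums_Fp p_pr (f := fun i => psi (ab i)) (D := L)
    (psi (y, z) - psi (\sum_(i in C1) ab i)).
- move=> i; rewrite inE => /andP[iB /eqP Hphi]; apply: contra (B0 i iB) => /eqP Hpsi.
  by apply/eqP/kernel0.
- by [].
have dis : [disjoint C1 & C2].
  apply: disjointW sC1 sC2 _; rewrite -setI_eq0; apply/eqP/setP => i.
  by rewrite !inE; case: (i \in B); case: (_ == 0).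
have sumE : \sum_(i in C1 :|: C2) ab i = (y, z).
  rewrite (eq_bigl [predU C1 & C2]); last by move=> i; rewrite !inE.
  rewrite bigU //=; set v1 := \sum_(i in C1) _; set v2 := \sum_(i in C2) _.
  have phiN v : phi (- v) = - phi v by rewrite -[RHS]addr0 -phi0 -(subrr v) phiD addKr.
  have psiN v : psi (- v) = - psi v by rewrite -[RHS]addr0 -psi0 -(subrr v) psiD addKr.
  apply/eqP; rewrite -subr_eq0; apply/eqP/kernel0.
    rewrite !phiD phiN -E1 -phi_sum -/v1 [phi v2]phi_sum big1 ?addr0 ?subrr //.
    by move=> i /(subsetP sC2); rewrite inE => /andP[_ /eqP].
  by rewrite !psiD psiN [psi v2]psi_sum E2 -/v1 addrCA subrr addr0 subrr.
exists (C1 :|: C2).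
  by rewrite subUset (subset_trans sC1 (subsetDl _ _)) (subset_trans sC2 sL).
split; first by rewrite -[RHS]/((y, z).1) -sumE raddf_sum.
by rewrite -[RHS]/((y, z).2) -sumE raddf_sum.
Qed.

(** Either some line through the origin carries p elements, and one argues one
dimension at a time, or every line is light enough for the polynomial method. *)
Theorem spread_subset_sums B s y z :
    (s < p)%N -> (p.-1.*2 + s <= #|B|)%N -> (forall i, i \in B -> ab i != 0) ->
    (#|form_roots ab B| <= s)%N ->
    (forall l m : F, (l, m) != 0 -> (p.-1 <= #|B :\: on_line ab B l m|)%N) ->
  exists2 C : {set I}, C \subset B &
    \sum_(i in C) (ab i).1 = y /\ \sum_(i in C) (ab i).2 = z.
Proof.
move=> sp cB B0 cR off.
have [/existsP[[l m] /andP[/= lm on]]|no] :=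
  boolP [exists lm : F * F, (lm != 0) && (p <= #|on_line ab B lm.1 lm.2|)%N].
  apply: (heavy_line_subset_sums y z lm B0 _ (off l m lm)).
  exact: leq_trans (leq_pred _) on.
apply: (thin_lines_subset_sums y z sp) => // l m lm; rewrite ltnNge.
by apply: contra no => H; apply/existsP; exists (l, m); rewrite lm.
Qed.

End PlaneSums.

(** * Choice of the parameters *)

Section Numerics.

(** For k = N this is (1 + 1/N)^N >= 2, without division. *)
Lemma two_power_step N k : (N ^ k * (N + k) <= N.+1 ^ k * N)%N.
Proof.
elim: k => [|k IH]; first by rewrite !expn0 addn0.
rewrite !expnS; move: IH; move: (N ^ k)%N (N.+1 ^ k)%N => x y; nia.
Qed.

Lemma poly_le_exp C d : exists l0, forall l, (l0 <= l)%N -> (C * l ^ d <= 2 ^ l)%N.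
Proof.
pose e := d.+1; exists (e * (C * e ^ d))%N => l Hl.
pose q := (l %/ e)%N.
have lq : (l <= e * q.+1)%N by rewrite mulnC ltnW // ltn_ceil.
have Cq : (C * e ^ d <= q.+1)%N.
  by rewrite ltnW // ltnS leq_divRL // mulnC.
apply: (@leq_trans (q.+1 ^ e)).
  rewrite expnS; apply: leq_trans (leq_mul Cq (leqnn _)).
  rewrite -mulnA leq_mul2l -expnMn; apply/orP; right.
  by elim: (d) => // j IH; rewrite !expnS leq_mul.
apply: (@leq_trans ((2 ^ q) ^ e)); first by rewrite leq_exp2r // ltn_expl.
by rewrite -expnM leq_pexp2l // leq_trunc_div.
Qed.

(** With l about log p, the growth factor 1 + 1/N for N = 8 m needs T = 3 l N
steps to exceed p^3, and t = 3 l repetitions suffice for flatness. So about m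
l^2 elements are spent, which is at most p / k for m of order p / (k l^2), and
kappa is of order k l^2. The constant 432 is 6 * 8 * 3 * 3, and 3456 is 8 * 432.
*)
Lemma structure_parameters k : (0 < k)%N -> exists p0, forall p, (p0 <= p)%N ->
  exists N m T t kappa, [/\ (0 < m <= p)%N, (8 * m <= N)%N, (4 * p <= kappa * m)%N,
    (forall h, (h <= 3)%N -> (N ^ T * p ^ h < N.+1 ^ T)%N /\ (p ^ h <= 2 ^ t)%N) &
    (k * (2 * T * t * 3) <= p)%N /\ (k * kappa ^ 3 <= p)%N].
Proof.
move=> k0.
have [l0 Hl0] := poly_le_exp (2 * (k * (3456 * k) ^ 3)) 6.
exists (2 ^ l0.+1)%N => p pl0.
have p0 : (0 < p)%N by apply: leq_trans pl0; rewrite expn_gt0.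
pose l := (trunc_log 2 p).+1.
have pl : (p < 2 ^ l)%N by apply: trunc_log_ltn.
have lp : (2 ^ l.-1 <= p)%N by apply: trunc_logP.
have l0l : (l0 <= l)%N.
  rewrite ltnW // -ltnS -(@ltn_exp2l 2) //; apply: leq_ltn_trans pl0 _.
  by apply: leq_trans pl _; rewrite leq_exp2l.
have big : (k * (3456 * k * l ^ 2) ^ 3 <= p)%N.
  have e2 : (2 ^ l = 2 * 2 ^ l.-1)%N by rewrite -expnS.
  have := Hl0 _ l0l; rewrite e2 -mulnA leq_pmul2l // => H.
  apply: leq_trans lp; apply: leq_trans H.
  by rewrite expnMn -expnM -mulnA.
pose kappa := (3456 * k * l ^ 2)%N.
have l2 : (0 < l ^ 2)%N by rewrite expn_gt0.
have kap0 : (0 < kappa)%N by rewrite /kappa muln_gt0 l2 muln_gt0 k0.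
have kapp : (kappa <= p)%N.
  apply: leq_trans big; rewrite -/kappa; apply: (@leq_trans (kappa ^ 3)).
    by rewrite -{1}(expn1 kappa) leq_pexp2l.
  by rewrite leq_pmull.
pose c := (432 * k * l ^ 2)%N.
have kc : kappa = (8 * c)%N by rewrite /kappa /c !mulnA.
have c0 : (0 < c)%N by rewrite /c muln_gt0 l2 muln_gt0 k0.
pose m := (p %/ c)%N.
have m0 : (0 < m)%N by rewrite divn_gt0 //; lia.
have mc : (m * c <= p)%N by apply: leq_trunc_div.
have pmc : (p < m.+1 * c)%N by apply: ltn_ceil.
exists (8 * m)%N, m, (8 * m * (3 * l))%N, (3 * l)%N, kappa.
have ph h : (h <= 3)%N -> (p ^ h <= 2 ^ (3 * l))%N.
  move=> h3; rewrite mulnC expnM; apply: (@leq_trans (p ^ 3)); first by rewrite leq_pexp2l.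
  by rewrite leq_exp2r // ltnW.
split=> //.
- by rewrite m0 leq_div.
- by rewrite kc; nia.
- move=> h h3; split; last exact: ph.
  set N := (8 * m)%N; have N0 : (0 < N)%N by rewrite muln_gt0.
  have dbl : (2 * N ^ N <= N.+1 ^ N)%N.
    by have := two_power_step N N; rewrite addnn -mul2n mulnA leq_pmul2r // mulnC.
  have ph' : (p ^ h < 2 ^ (3 * l))%N.
    rewrite mulnC expnM; apply: (@leq_ltn_trans (p ^ 3)); first by rewrite leq_pexp2l.
    by rewrite ltn_exp2r.
  apply: (@leq_trans (N ^ (N * (3 * l)) * 2 ^ (3 * l))).
    by rewrite ltn_pmul2l // expn_gt0 N0.
  by rewrite (expnM N N) (expnM N.+1 N) -expnMn [(N ^ N * 2)%N]mulnC leq_exp2r.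
- split=> //; apply: leq_trans mc; rewrite /c; move: (l) (m) => x y; rewrite expnS expn1; nia.
Qed.

End Numerics.

(** * Completing a sum modulo the filled coset *)

Section SubspaceCases.
Variables (p : nat) (p_pr : prime p) (n : nat).
Local Notation V := 'rV['F_p]_n.
Implicit Types (A R B X : {set V}).

Definition has_zero_sum A : Prop :=
  exists B : {set V}, [/\ B \subset A, B != set0 & \sum_(b in B) b = 0].

Lemma has_zero_sumS A A' : A \subset A' -> has_zero_sum A -> has_zero_sum A'.
Proof. by move=> s [B [sB B0 E]]; exists B; split=> //; apply: subset_trans s. Qed.

Definition in_space m (M : 'M['F_p]_(m, n)) A : Prop :=
  forall a : V, a \in A -> (a <= M)%MS.

Lemma sum_in_space m (M : 'M_(m, n)) A : in_space M A -> ((\sum_(a in A) a)%R <= M)%MS.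
Proof. by move=> HA; apply: summx_sub => a /HA. Qed.

(** The element a0 is set aside and always used, so that the resulting zero sum
is not empty; it is absorbed in the base point x. *)
Lemma realizes_zero_sum m (M : 'M_(m, n)) h (M' : 'M_(h, n)) A R a0 :
    in_space M A -> R \subset A -> realizes R M' setT -> a0 \in A :\: R ->
  exists2 x : V, (x <= M)%MS & forall C : {set V}, C \subset (A :\: R) :\ a0 ->
    ((x + \sum_(c in C) c)%R <= M')%MS -> has_zero_sum A.
Proof.
move=> AM sR [x Hx] /setDP[a0A a0R].
have [B0 sB0 E0] := Hx 0 (in_setT _); rewrite mul0mx addr0 in E0.
exists (x + a0).
  apply: addmx_sub; last exact: AM.
  by rewrite -E0; apply: sum_in_space => a /(subsetP sB0)/(subsetP sR)/AM.
move=> C sC /submxP[u Eu].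
have [B sB EB] := Hx (- u) (in_setT _).
have CA c : c \in C -> [/\ c != a0, c \in A & c \notin R].
  by move=> /(subsetP sC); rewrite !inE => /and3P[].
have a0C : a0 \notin C by apply/negP => /CA[]; rewrite eqxx.
have dis : [disjoint a0 |: C & B].
  rewrite -setI_eq0; apply/eqP/setP => c; rewrite !inE.
  apply/negP => /andP[/orP[/eqP->|/CA[_ _ cR]] /(subsetP sB)]; first by rewrite (negPf a0R).
  by rewrite (negPf cR).
exists ((a0 |: C) :|: B); split.
- rewrite !subUset sub1set a0A (subset_trans sB sR) andbT /=.
  by apply/subsetP => c /CA[].
- by apply/set0Pn; exists a0; rewrite !inE eqxx.
rewrite (eq_bigl [predU (a0 |: C) & B]); last by move=> i; rewrite !inE.
rewrite bigU //= big_setU1 //= EB mulNmx -Eu.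
by rewrite -[x + a0 + _]addrA opprD [X in _ + X]addrA subrr add0r subrr.

Qed.

Lemma zero_sum_full m (M : 'M_(m, n)) h (M' : 'M_(h, n)) A R a0 :
    in_space M A -> R \subset A -> realizes R M' setT -> a0 \in A :\: R ->
  (M <= M')%MS -> has_zero_sum A.
Proof.
move=> AM sR rR a0A sM.
have [x xM Hx] := realizes_zero_sum AM sR rR a0A.
apply: (Hx set0); rewrite ?sub0set // big_set0 addr0.
exact: submx_trans xM sM.
Qed.

(** A column of the cokernel of M' that does not kill M is such a functional,
since its kernel in M already has the dimension of M'. *)
Lemma hyperplane_functional m (M : 'M['F_p]_(m, n)) h (M' : 'M['F_p]_(h, n)) :
    (M' <= M)%MS -> \rank M = (\rank M').+1 ->
  exists w : 'cV['F_p]_n, forall v : V, (v <= M)%MS -> (v <= M')%MS = (v *m w == 0).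
Proof.
move=> sM rM.
have [j Mj] : exists j, M *m col j (cokermx M') != 0.
  apply/existsP; rewrite -negb_forall; apply/negP => /forallP H.
  have : (M <= M')%MS.
    rewrite submxE; apply/eqP/matrixP => i j; have /eqP/colP/(_ i) := H j.
    by rewrite colE mulmxA -colE !mxE.
  by move/mxrankS; rewrite rM ltnn.
pose w := col j (cokermx M'); exists w => v vM.
have M'w : M' *m w = 0 by rewrite /w colE mulmxA mulmx_coker mul0mx.
apply/idP/eqP => [/submxP[D ->]|vw]; first by rewrite -mulmxA M'w mulmx0.
have sMw : (M' <= M :&: kermx w)%MS by rewrite sub_capmx sM; apply/sub_kermxP.
have : (M :&: kermx w <= M')%MS.
  rewrite -(mxrank_leqif_sup sMw).2 eqn_leq mxrankS //= -ltnS -rM.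
  apply: rank_ltmx; rewrite /ltmx capmxSl /=; apply: contra Mj => sMk.
  by apply/eqP/sub_kermxP; apply: submx_trans sMk (capmxSr _ _).
by apply: submx_trans; rewrite sub_capmx vM; apply/sub_kermxP.
Qed.

Lemma zero_sum_codim1 m (M : 'M_(m, n)) h (M' : 'M_(h, n)) A R a0 :
    in_space M A -> R \subset A -> realizes R M' setT -> a0 \in A :\: R ->
    (M' <= M)%MS -> \rank M = (\rank M').+1 ->
    (p.-1 <= #|[set a in (A :\: R) :\ a0 | ~~ (a <= M')%MS]|)%N ->
  has_zero_sum A.
Proof.
move=> AM sR rR a0A sM rM; set D := [set _ in _ | _] => cD.
have [w Hw] := hyperplane_functional sM rM.
have [x xM Hx] := realizes_zero_sum AM sR rR a0A.
have DA a : a \in D -> a \in A by rewrite !inE => /andP[/and3P[]].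
have [|//|C sC EC] := subset_sums_Fp p_pr (f := fun a : V => (a *m w) 0 0) (D := D) (- (x *m w) 0 0).
  move=> a aD; have := aD; rewrite inE => /andP[_]; rewrite Hw ?AM ?DA //.
  by apply: contra => /eqP E; apply/eqP/matrixP => i j; rewrite !ord1 E mxE.
apply: (Hx C).
  by apply: subset_trans sC _; apply/subsetP => a; rewrite inE => /andP[].
rewrite Hw; last first.
  by apply: addmx_sub => //; apply: sum_in_space => a /(subsetP sC)/DA/AM.
apply/eqP/matrixP => i j; rewrite !ord1 mulmxDl mulmx_suml mxE summxE EC.
by rewrite subrr mxE.
Qed.

End SubspaceCases.

Section Codim2.
Variables (p : nat) (p_pr : prime p).
Local Notation V := 'rV['F_p]_3.
Implicit Types (A R B X : {set V}).

Lemma quotient_plane (M' : 'M['F_p]_(1, 3)) : row_free M' ->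
  exists2 Q : 'M['F_p]_(3, 2), row_full Q & forall v : V, (v <= M')%MS = (v *m Q == 0).
Proof.
move=> fM; pose K := cokermx M'.
have rK : \rank K = 2.
  by rewrite mxrank_coker; move: fM; rewrite /row_free => /eqP->.
have resize m : m = 2 -> forall L : 'M['F_p]_(3, m), row_full L ->
    (forall v : V, (v <= M')%MS = (v *m L == 0)) ->
    exists2 Q : 'M['F_p]_(3, 2), row_full Q & forall v : V, (v <= M')%MS = (v *m Q == 0).
  by move=> -> L fL HL; exists L.
apply: (resize _ rK (col_base K) (col_base_full K)) => v.
rewrite submxE -/K -[in LHS](mulmx_base K) mulmxA.
apply/eqP/eqP => [|->]; last by rewrite mul0mx.
by move=> E; apply: (row_free_inj (row_base_free K)); rewrite E mul0mx.
Qed.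

Definition pair_of_row (u : 'rV['F_p]_2) : 'F_p * 'F_p := (u 0 0, u 0 1).

Lemma pair_of_row_eq0 u : (pair_of_row u == 0) = (u == 0).
Proof.
apply/eqP/eqP => [[u0 u1]|->]; last by rewrite /pair_of_row !mxE.
apply/rowP => j; rewrite mxE.
by case: j => [[|[|]]] //= jP; [rewrite -u0 | rewrite -u1]; congr (u _ _); apply: val_inj.
Qed.

(** In the plane of the classes modulo M', the linear forms attached to the
elements of A have at most #|X| roots, because A \ R meets at most #|X| cosets
of M'. *)
Lemma zero_sum_codim2 (M' : 'M['F_p]_(1, 3)) A R X a0 (Q : 'M['F_p]_(3, 2)) :
    R \subset A -> realizes R M' setT -> a0 \in A :\: R ->
    (forall v : V, (v <= M')%MS = (v *m Q == 0)) ->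
    covers X M' (A :\: R) ->
    let B := [set a in (A :\: R) :\ a0 | ~~ (a <= M')%MS] in
    let ab := fun a : V => pair_of_row (a *m Q) in
    (#|X| < p)%N -> (p.-1.*2 + #|X| <= #|B|)%N ->
    (forall l m : 'F_p, (l, m) != 0 -> (p.-1 <= #|B :\: on_line ab B l m|)%N) ->
  has_zero_sum A.
Proof.
move=> sR rR a0A HQ cov B ab Xp cB off.
have AM : in_space (1%:M : 'M['F_p]_3) A by move=> a _; apply: submx1.
have [x xM Hx] := realizes_zero_sum AM sR rR a0A.
have roots : (#|form_roots ab B| <= #|X|)%N.
  apply: leq_trans (leq_imset_card (fun x => form_root (ab x)) X).
  apply/subset_leq_card/subsetP => r /imsetP[a]; rewrite !inE => /andP[/andP[/andP[_ aA] _] _] ->.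
  have /cov[y yX] : a \in A :\: R by rewrite inE.
  rewrite HQ mulmxBl subr_eq0 => /eqP E.
  by apply/imsetP; exists y; rewrite // /ab E.
have B0 a : a \in B -> ab a != 0.
  by rewrite inE => /andP[_]; rewrite HQ /ab pair_of_row_eq0.
have [C sC [E1 E2]] := spread_subset_sums p_pr (- (x *m Q) 0 0) (- (x *m Q) 0 1) Xp cB B0 roots off.
apply: (Hx C).
  by apply: subset_trans sC _; apply/subsetP => a; rewrite inE => /andP[].
rewrite HQ -pair_of_row_eq0 mulmxDl mulmx_suml; apply/eqP.
rewrite /ab /pair_of_row /= in E1 E2; rewrite -[RHS]/((0, 0) : 'F_p * 'F_p).
by congr pair; rewrite mxE summxE ?E1 ?E2 subrr.
Qed.

End Codim2.

(** * Dense sets have zero sums *)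

Lemma dense_structure k : (0 < k)%N -> exists p0, forall p, prime p -> (p0 <= p)%N ->
  forall m (M : 'M['F_p]_(m, 3)) (A : {set 'rV['F_p]_3}), in_space M A -> (2 * p < k * #|A|)%N ->
  exists h (M' : 'M['F_p]_(h, 3)) (R X : {set 'rV['F_p]_3}),
    [/\ (0 < h)%N, row_free M', (M' <= M)%MS & R \subset A] /\
    [/\ realizes R M' setT, covers X M' (A :\: R), (k * #|R| <= p)%N & (k * #|X| <= p)%N].
Proof.
move=> k0; have [p0 Hp0] := structure_parameters k0.
exists p0 => p p_pr /Hp0[N [m [T [t [kappa [m0p mN km HT [c1 c2]]]]]]].
move=> m' M A AM cA.
have rM : (\rank M <= 3)%N by apply: rank_leq_col.
have kap0 : (0 < kappa)%N.
  by case: kappa km {c2} => //; rewrite mul0n leqn0 muln_eq0 /= -leqn0 leqNgt prime_gt0.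
have c1' : (k * (2 * T * t * \rank M) <= p)%N.
  by apply: leq_trans c1; rewrite leq_mul2l leq_mul2l rM !orbT.
have c2' : (k * (1 * kappa ^ \rank M) <= p)%N.
  by apply: leq_trans c2; rewrite mul1n leq_mul2l leq_pexp2l ?orbT.
have [HTr Htr] := HT _ rM.
have cov : covers [set 0] (row_base M) A.
  by move=> a /AM aM; exists 0; rewrite ?inE // subr0 eq_row_base.
have [|h [M' [R [X [[h0 fM' sM' sR cR] [rR cov' cX]]]]]] :=
  coset_in_subset_sums p_pr (row_base_free M) m0p mN km HTr Htr cov.
  rewrite cards1 -(ltn_pmul2l k0) mulnDr.
  by apply: leq_ltn_trans cA; rewrite [(2 * p)%N]mul2n -addnn leq_add.
rewrite cards1 in cX.
exists h, M', R, X; split; split=> //.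
- by apply: submx_trans sM' _; rewrite eq_row_base.
- by apply: leq_trans c1'; rewrite leq_mul2l cR orbT.
- by apply: leq_trans c2'; rewrite leq_mul2l cX orbT.
Qed.

(** For subspaces of dimension at most d + 1 the threshold is (d + 1/k) p
elements. *)
Definition dense_zero_sum (d : nat) : Prop :=
  forall k, (0 < k)%N -> exists p0, forall p, prime p -> (p0 <= p)%N ->
  forall m (M : 'M['F_p]_(m, 3)) (A : {set 'rV['F_p]_3}), in_space M A -> (\rank M <= d.+1)%N ->
    ((k * d + 1) * p <= k * #|A|)%N -> has_zero_sum A.

Lemma card_split p (A R : {set 'rV['F_p]_3}) a0 m (M : 'M['F_p]_(m, 3)) :
    R \subset A -> a0 \in A :\: R ->
  (#|A| = #|R| + 1 + #|[set a in (A :\: R) :\ a0 | (a <= M)%MS]|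
     + #|[set a in (A :\: R) :\ a0 | ~~ (a <= M)%MS]|)%N.
Proof.
move=> sR a0A.
rewrite -(cardsID R A) (setIidPr sR) (cardsD1 a0 (A :\: R)) a0A -!addnA; congr (_ + (_ + _))%N.
rewrite -(cardsID [set a in (A :\: R) :\ a0 | (a <= M)%MS] ((A :\: R) :\ a0)); congr (_ + _)%N.
  by apply: eq_card => a; rewrite !inE; case: (a == a0); case: (a \in R); case: (a \in A).
by apply: eq_card => a; rewrite !inE; case: (a == a0); case: (a \in R); case: (a \in A);
  rewrite ?andbF ?andbT.
Qed.

Lemma has_zero_sum_in p (A R : {set 'rV['F_p]_3}) a0 (P : pred 'rV['F_p]_3) :
  has_zero_sum [set a in (A :\: R) :\ a0 | P a] -> has_zero_sum A.
Proof.
apply: has_zero_sumS; apply/subsetP => a; rewrite !inE.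
by case/andP => /and3P[].
Qed.

Lemma dense_zero_sum_line : dense_zero_sum 0.
Proof.
move=> k k0; have [|p0 Hp0] := @dense_structure (3 * k); first by rewrite muln_gt0 k0.
exists p0 => p p_pr pp0 m M A AM rM; rewrite muln0 add0n mul1n => cA.
have ppos := prime_gt0 p_pr.
have [|h [M' [R [X [[h0 fM' sM' sR] [rR _ cR _]]]]]] := Hp0 p p_pr pp0 m M A AM.
  by move: cA ppos; clear; lia.
have /set0Pn[a0 a0A] : A :\: R != set0.
  rewrite -card_gt0 cardsD (setIidPr sR) subn_gt0 -(ltn_pmul2l k0).
  by move: cA cR ppos; clear; lia.
apply: (zero_sum_full AM sR rR a0A).
rewrite -(mxrank_leqif_sup sM').2 eqn_leq mxrankS //=.
by apply: leq_trans rM _; move: fM'; rewrite /row_free => /eqP->.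
Qed.

(** Fewer than p - 1 elements of A lie outside M' if no zero sum is found there,
so that M' inherits a density that exceeds the threshold of the next lower
dimension; the density 1/k is halved to absorb R and the other lower order
terms. *)
Lemma dense_zero_sum_descend d k p m (M : 'M['F_p]_(m, 3)) h (M' : 'M['F_p]_(h, 3))
    (A R : {set 'rV['F_p]_3}) a0 : prime p -> (0 < k)%N -> (4 * k <= p)%N ->
    (forall m (M : 'M['F_p]_(m, 3)) (A : {set 'rV['F_p]_3}), in_space M A ->
      (\rank M <= d.+1)%N -> ((2 * k * d + 1) * p <= 2 * k * #|A|)%N -> has_zero_sum A) ->
    in_space M A -> (\rank M <= d.+2)%N -> ((k * d.+1 + 1) * p <= k * #|A|)%N ->
    R \subset A -> realizes R M' setT -> a0 \in A :\: R -> (4 * k * #|R| <= p)%N ->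
    (M' <= M)%MS -> \rank M = (\rank M').+1 ->
  has_zero_sum A.
Proof.
move=> p_pr k0 kp IH AM rM cA sR rR a0A cR sM rMM.
have [cD|cD] := leqP p.-1 #|[set a in (A :\: R) :\ a0 | ~~ (a <= M')%MS]|.
  exact: (zero_sum_codim1 p_pr AM sR rR a0A sM rMM cD).
apply: (@has_zero_sum_in _ _ R a0 (fun a => a <= M')%MS).
apply: (IH h M'); first by move=> a; rewrite inE => /andP[].
  by rewrite -ltnS -rMM.
have := card_split M' sR a0A; have := prime_gt0 p_pr.
move: cD cA cR kp; move: #|A| #|R| #|[set a in _ | (a <= M')%MS]| #|[set a in _ | ~~ _]|.
move=> x r y z; clear -k0 => zp cA cR kp pp xE.
have zp' : (z + 2 <= p)%N by lia.
have kz : (k * (z + 2) <= k * p)%N by rewrite leq_mul2l zp' orbT.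
rewrite xE in cA; move: cA cR kz kp; clear -k0 pp; lia.
Qed.

Lemma dense_zero_sum_plane : dense_zero_sum 1.
Proof.
move=> k k0; have [|p0 Hp0] := @dense_structure (4 * k); first by rewrite muln_gt0 k0.
have [|p1 Hp1] := @dense_zero_sum_line (2 * k); first by rewrite muln_gt0 k0.
exists (p0 + p1 + 4 * k)%N => p p_pr pp m M A AM rM cA.
have [pp0 pp1 pk] : [/\ p0 <= p, p1 <= p & 4 * k <= p]%N by split; move: pp; clear; lia.
have ppos := prime_gt0 p_pr.
have [|h [M' [R [X [[h0 fM' sM' sR] [rR _ cR _]]]]]] := Hp0 p p_pr pp0 m M A AM.
  by move: cA ppos k0; clear; nia.
have /set0Pn[a0 a0A] : A :\: R != set0.
  rewrite -card_gt0 cardsD (setIidPr sR) subn_gt0 -(ltn_pmul2l k0).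
  by move: cA cR ppos k0; clear; nia.
have [MM'|sMN] := boolP (M <= M')%MS; first exact: (zero_sum_full AM sR rR a0A MM').
have rM' : \rank M' = h by move: fM'; rewrite /row_free => /eqP.
have rlt : (\rank M' < \rank M)%N by apply: rank_ltmx; rewrite /ltmx sM'.
apply: (dense_zero_sum_descend p_pr k0 pk (Hp1 p p_pr pp1) AM rM cA sR rR a0A cR sM').
by rewrite rM' in rlt *; move: rlt rM h0; clear; lia.
Qed.

(** According to the codimension of the subspace M' whose coset is filled: 0 is
immediate, 1 is a descent, and in codimension 2 either M' itself or a plane
through M' is dense, or the remaining elements are spread over the quotient
plane. *)
Lemma dense_zero_sum_space : dense_zero_sum 2.
Proof.
move=> k k0; have [|p0 Hp0] := @dense_structure (8 * k); first by rewrite muln_gt0 k0.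
have [|p1 Hp1] := @dense_zero_sum_line (4 * k); first by rewrite muln_gt0 k0.
have [|p2 Hp2] := @dense_zero_sum_plane (2 * k); first by rewrite muln_gt0 k0.
exists (p0 + p1 + p2 + 8 * k)%N => p p_pr pp m M A AM rM cA.
have [pp0 pp1 pp2 pk] : [/\ p0 <= p, p1 <= p, p2 <= p & 8 * k <= p]%N.
  by split; move: pp; clear; lia.
have ppos := prime_gt0 p_pr.
have [|h [M' [R [X [[h0 fM' sM' sR] [rR cov cR cX]]]]]] := Hp0 p p_pr pp0 m M A AM.
  by move: cA ppos k0; clear; nia.
have /set0Pn[a0 a0A] : A :\: R != set0.
  rewrite -card_gt0 cardsD (setIidPr sR) subn_gt0 -(ltn_pmul2l k0).
  by move: cA cR ppos k0; clear; nia.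
have [MM'|sMN] := boolP (M <= M')%MS; first exact: (zero_sum_full AM sR rR a0A MM').
have rM' : \rank M' = h by move: fM'; rewrite /row_free => /eqP.
have rlt : (\rank M' < \rank M)%N by apply: rank_ltmx; rewrite /ltmx sM'.
have cR4 : (4 * k * #|R| <= p)%N.
  by apply: leq_trans cR; rewrite !leq_mul2r !orbT.
have pk4 : (4 * k <= p)%N by apply: leq_trans pk; rewrite leq_mul2r orbT.
have [rMM|rMM] := eqVneq (\rank M) (\rank M').+1.
  exact: (dense_zero_sum_descend p_pr k0 pk4 (Hp2 p p_pr pp2) AM rM cA sR rR a0A cR4 sM').
have h1 : h = 1%N by rewrite rM' in rlt rMM; move: rlt rMM rM h0; clear; lia.
subst h.
have [Q fQ HQ] := quotient_plane fM'.
pose C := (A :\: R) :\ a0.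
have [cL|cL] := leqP p (4 * k * #|[set a in C | (a <= M')%MS]|).
  apply: (@has_zero_sum_in _ _ R a0 (fun a => a <= M')%MS).
  apply: (Hp1 p p_pr pp1 _ M'); first by move=> a; rewrite inE => /andP[].
    by rewrite rM'.
  by rewrite muln0 add0n mul1n.
have cE := card_split M' sR a0A.
rewrite -/C in cE.
set B := [set a in C | ~~ (a <= M')%MS] in cE.
pose ab (a : 'rV['F_p]_3) := pair_of_row (a *m Q).
have cB : (16 * k * p + 5 * p <= 8 * k * #|B| + 8 * k)%N.
  have cA8 : (8 * ((k * 2 + 1) * p) <= 8 * (k * #|A|))%N by rewrite leq_mul2l.
  move: cA8; rewrite cE; move: cR cL; move: #|R| #|[set a in C | _]| #|B| => r y z.
  by clear; lia.
have [[l mm] /andP[/= lm cl]|off] := pickP (fun lm : 'F_p * 'F_p =>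
    (lm != 0) && (#|B :\: on_line ab B lm.1 lm.2| < p.-1)%N); last first.
  apply: (zero_sum_codim2 p_pr sR rR a0A HQ cov).
  - rewrite -(ltn_pmul2l k0); move: cX k0 ppos; clear; nia.
  - rewrite -/C -/B -(leq_pmul2l (_ : 0 < 8 * k)%N) ?muln_gt0 ?k0 //.
    move: cB cX; move: #|B| #|X| => z x; rewrite -mul2n mulnDr.
    have -> : (8 * k * (2 * p.-1) = 16 * k * p - 16 * k)%N.
      by rewrite -subn1 !mulnBr !muln1 mulnA; congr (_ - _)%N; ring.
    by move: (8 * k * x)%N => w; clear -k0 ppos; nia.
  - by move=> l mm lm; rewrite leqNgt; have := off (l, mm); rewrite /= lm /= => ->.
pose w : 'cV['F_p]_2 := \col_i (if i == 0 then l else mm).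
apply: (has_zero_sumS (A := on_line ab B l mm)).
  by apply/subsetP => a; rewrite !inE => /andP[/andP[/and3P[]]].
have w0 : w != 0.
  apply: contra lm => /eqP w0; have := congr1 (fun u : 'cV_2 => u 0 0) w0.
  have := congr1 (fun u : 'cV_2 => u 1 0) w0; rewrite !mxE /= => -> ->.
  exact: eqxx.
apply: (Hp2 p p_pr pp2 _ (kermx (Q *m w))).
- move=> a; rewrite inE => /andP[_ /eqP E]; apply/sub_kermxP/matrixP => i j.
  rewrite !ord1 mulmxA mxE !big_ord_recl big_ord0 addr0 [w _ _]mxE [X in _ + _ * X]mxE /= [RHS]mxE.
  by rewrite -E /ab /pair_of_row /= mulrC [mm * _]mulrC; congr (_ + _ * _); congr (_ _ _); apply: val_inj.
- have : (0 < \rank (Q *m w))%N.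
    rewrite lt0n mxrank_eq0; apply: contra w0 => /eqP Qw0.
    by have /row_fullP[Q' Q'Q] := fQ; rewrite -[w]mul1mx -Q'Q -mulmxA Qw0 mulmx0.
  by rewrite mxrank_ker; clear; lia.
- have := cardsID (on_line ab B l mm) B.
  rewrite (setIidPr _); last by apply/subsetP => a; rewrite inE => /andP[].
  move: cl cB; move: #|B| #|on_line ab B l mm| #|B :\: _| => z x y yp cB zE.
  have yp' : (y + 2 <= p)%N by move: yp; clear; lia.
  have ky : (8 * k * (y + 2) <= 8 * k * p)%N by rewrite leq_mul2l yp' orbT.
  rewrite -zE in cB; rewrite -(leq_pmul2l (_ : 0 < 4)%N) //.
  by move: cB ky; clear; lia.
Qed.

Lemma olson_constant_le p k n : (0 < k)%N ->
    (forall m (M : 'M['F_p]_(m, 3)) (A : {set 'rV['F_p]_3}), in_space M A ->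
      (\rank M <= 3)%N -> ((k * 2 + 1) * p <= k * #|A|)%N -> has_zero_sum A) ->
    ((k * 2 + 1) * p <= k * n)%N -> (olson_constant 'rV['F_p]_3 <= n)%N.
Proof.
move=> k0 H cn; rewrite /olson_constant; case: ex_minnP => m _; apply.
apply/forallP => A; apply/implyP => /eqP cA.
have [|||B [sB B0 E]] := H 3 1%:M A.
- by move=> a _; apply: submx1.
- by rewrite rank_leq_col.
- by rewrite cA.
rewrite /zero_sum_free negbK; apply/imsetP; exists B => //.
by rewrite !inE sB.
Qed.

(** The excess density 1/k and the rounding to an integer cost at most p / k
each, and 2 / k <= gamma. *)
Theorem theorem1p6 (R : realType) (gamma : R) (hgamma : 0 < gamma) :
  exists p0 : nat, forall p : nat, prime p -> (p0 <= p)%N ->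
    (olson_constant 'rV['F_p]_3)%:R <= (2 + gamma) * p%:R.
Proof.
have [k k_gt0 kg] : exists2 k : nat, (0 < k)%N & 2 <= gamma * k%:R.
  exists (Num.bound (2 / gamma)).+1 => //.
  rewrite mulrC -ler_pdivrMr // ltW // (lt_le_trans (archi_boundP _)) ?ler_nat //.
  by rewrite divr_ge0 // ltW.
have [//|p0 Hp0] := @dense_zero_sum_space k.
exists (p0 + k)%N => p p_pr pp.
have [pp0 pk] : (p0 <= p)%N /\ (k <= p)%N by split; move: pp; clear; lia.
pose n := ((k * 2 + 1) * p %/ k).+1.
have kn : ((k * 2 + 1) * p <= k * n)%N by rewrite mulnC [X in (_ <= X)%N]mulnC mulnC ltnW // ltn_ceil.
have nk : (n * k <= (k * 2 + 2) * p)%N.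
  rewrite /n mulSn; have := leq_trunc_div ((k * 2 + 1) * p) k.
  by move: pk; move: (_ %/ _)%N; clear; nia.
apply: (@le_trans _ _ n%:R).
  by rewrite ler_nat; apply: (olson_constant_le _ (Hp0 p p_pr pp0)).
have k0 : 0 < k%:R :> R by rewrite ltr0n.
rewrite -(ler_pM2r k0) -natrM; apply: (@le_trans _ _ ((k * 2 + 2) * p)%N%:R); first by rewrite ler_nat.
rewrite natrM natrD natrM [leRHS]mulrAC ler_wpM2r ?ler0n // mulrDl.
by rewrite [2 * _]mulrC lerD2l.
Qed.
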